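(* Let $R$ be a regular, $F$-finite ring essentially of finite type over a finite field of characteristic $p>0$, and let $\mathfrak{a}_1,\ldots,\mathfrak{a}_n$ be nonzero ideals of $R$. Then there is a $p$-fractal function $\varphi:\mathbb{R}_{\geq 0}^n\to\mathbb{N}$ for which $$\tau(\mathfrak{a}_1^{c_1}\cdots\mathfrak{a}_n^{c_n})=\tau(\mathfrak{a}_1^{d_1}\cdots\mathfrak{a}_n^{d_n})\iff \varphi(c_1,\ldots,c_n)=\varphi(d_1,\ldots,d_n),$$ and therefore the constancy regions are of the form $\varphi^{-1}(i)$ for some number $i$.
   Context: A ring $R$ of characteristic $p>0$ is $F$-finite if the Frobenius map $F:R\to R$ is finite. For an ideal $J$ of $R$, $J^{[p^e]}=(f^{p^e}\mid f\in J)$; for an ideal $\mathfrak{b}$, $\mathfrak{b}^{[1/p^e]}$ denotes the smallest ideal $J$ such that $\mathfrak{b}\subseteq J^{[p^e]}$ (it exists in this setting). For $c_1,\dots,c_n\in\mathbb{R}_{\ge0}$ the mixed test ideal is $$\tau(\mathfrak{a}_1^{c_1}\cdots\mathfrak{a}_n^{c_n})=\bigcup_{e>0}\bigl(\mathfrak{a}_1^{\lceil c_1p^e\rceil}\cdots\mathfrak{a}_n^{\lceil c_np^e\rceil}\bigr)^{[1/p^e]},$$ which equals the $e$-th ideal in the union for all $e$ large enough. The constancy region for $\tau(\mathfrak{a}_1^{c_1}\cdots\mathfrak{a}_n^{c_n})$ is the set of all $c'\in\mathbb{R}^n_{\ge0}$ with $\tau(\mathfrak{a}_1^{c'_1}\cdots\mathfrak{a}_n^{c'_n})=\tau(\mathfrak{a}_1^{c_1}\cdots\mathfrak{a}_n^{c_n})$.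 $p$-fractals: let $\mathcal{F}$ be the algebra of functions $\phi:\mathbb{R}_{\ge0}^n\to\mathbb{Q}$. For each $q=p^e$ and every $b=(b_1,\dots,b_n)\in\mathbb{Z}^n$ with $0\le b_i<q$, the operator $T_{q|b}:\mathcal{F}\to\mathcal{F}$ is defined by $T_{q|b}\phi(t_1,\dots,t_n)=\phi\bigl((t_1+b_1)/q,\dots,(t_n+b_n)/q\bigr)$. For $l=(l_1,\dots,l_n)$ with positive real $l_i$, write $[0,l]=[0,l_1]\times\cdots\times[0,l_n]$. A map $\phi:[0,l]\to\mathbb{Q}$, extended by zero to a function on $\mathbb{R}_{\ge0}^n$ that is also denoted $\phi$, is called a $p$-fractal if all the $T_{q|b}\phi$ span a finite-dimensional $\mathbb{Q}$-subspace of $\mathcal{F}$. An arbitrary $\phi\in\mathcal{F}$ is called a $p$-fractal if its restriction to each hypercube $[0,l]$ is a $p$-fractal.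
   Formalization: In the definition of p-fractal, the T_{q|b}φ are restricted to [0,l] (then extended by zero) before taking their span; extending φ|[0,l] by zero first and comparing on all of R_{≥0}^n gives functions of growing support, so the claim would fail already for F_p[x] and the ideal (x). *)

(* Defs.v *)
From HB Require Import structures.
From mathcomp Require Import all_boot all_order all_algebra.
From mathcomp Require Import mathcomp_extra boolp classical_sets functions.
From mathcomp Require Import reals interval_inference ring.

Set Implicit Arguments.
Unset Strict Implicit.
Unset Printing Implicit Defensive.
Import Order.TTheory GRing.Theory Num.Theory.
Local Open Scope classical_set_scope.
Local Open Scope ring_scope.

Section Modules.
Variables (A : pzRingType) (M : lmodType A).

Definition submodule (W : set M) : Prop :=
  W 0 /\ forall (a : A) (u v : M), W u -> W v -> W (a *: u + v).

Definition span (S : set M) : set M := smallest submodule S.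

Definition finitely_generated (W : set M) : Prop :=
  exists s : seq M, W = span [set` s].

End Modules.

Section Ideals.
Variable R : comNzRingType.

Definition ideal (I : set R) : Prop := @submodule R R^o I.

Definition ideal_gen (S : set R) : set R := @span R R^o S.

Definition ideal_mul (I J : set R) : set R :=
  ideal_gen [set z | exists x y, [/\ I x, J y & z = x * y]].

Definition ideal_exp (I : set R) (m : nat) : set R := iter m (ideal_mul I) setT.

Definition prime_ideal (P : set R) : Prop :=
  [/\ ideal P, ~ P 1 & forall x y, P (x * y) -> P x \/ P y].

Definition maximal_ideal (m : set R) : Prop :=
  [/\ ideal m, ~ m 1 & forall J, ideal J -> ~ J 1 -> m `<=` J -> J = m].

Definition noetherian : Prop :=
  forall I : set R, ideal I -> @finitely_generated R R^o I.

(* A chain of length l has l.+1 members P_0 < ... < P_l. *)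
Definition has_prime_chain (l : nat) : Prop :=
  exists P : 'I_l.+1 -> set R,
    (forall i, prime_ideal (P i)) /\
    (forall i j : 'I_l.+1, (i < j)%N -> P i `<` P j).

Definition krull_dim_eq (d : nat) : Prop :=
  has_prime_chain d /\ forall l, has_prime_chain l -> (l <= d)%N.

Definition local_with (m : set R) : Prop :=
  maximal_ideal m /\ forall m', maximal_ideal m' -> m' = m.

Definition regular_local : Prop :=
  noetherian /\
  exists (m : set R) (d : nat),
    [/\ local_with m, krull_dim_eq d
      & exists x : d.-tuple R, m = ideal_gen [set` x]].

End Ideals.

Section Rings.
Variable R : comNzRingType.

Definition mult_closed (S : set R) : Prop :=
  S 1 /\ forall x y, S x -> S y -> S (x * y).

(* The map f exhibits B as the ring of fractions of R with denominators in S;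
   this determines (B, f) up to unique isomorphism. *)
Definition is_localization (S : set R) (B : comNzRingType) (f : {rmorphism R -> B})
    : Prop :=
  [/\ forall s, S s -> exists y, f s * y = 1,
      forall b, exists x s, S s /\ b * f s = f x
    & forall x, f x = 0 -> exists s, S s /\ s * x = 0].

Definition regular : Prop :=
  noetherian R /\
  forall P, prime_ideal P ->
    exists (B : comNzRingType) (f : {rmorphism R -> B}),
      is_localization (~` P) f /\ regular_local B.

(* For a ring of characteristic p: R is a finite module over itself through the
   Frobenius map. *)
Definition F_finite (p : nat) : Prop :=
  exists (m : nat) (s : 'I_m -> R),
    forall x, exists c : 'I_m -> R, x = \sum_(i < m) c i ^+ p * s i.

Definition frob_power (J : set R) (q : nat) : set R :=
  ideal_gen [set z | exists2 x, J x & z = x ^+ q].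

(* The smallest ideal J with b `<=` J^[q], written as the intersection of all
   such ideals: the two agree whenever a smallest one exists. *)
Definition frob_root (b : set R) (q : nat) : set R :=
  \bigcap_(J in [set J | ideal J /\ b `<=` frob_power J q]) J.

End Rings.

Section EssentiallyFiniteType.
Variable k : fieldType.

Definition subalgebra (A : comAlgType k) (B : set A) : Prop :=
  [/\ submodule B, B 1 & forall x y, B x -> B y -> B (x * y)].

Definition finite_type (A : comAlgType k) : Prop :=
  exists s : seq A, smallest (@subalgebra A) [set` s] = setT.

Definition essentially_finite_type (R : comAlgType k) : Prop :=
  exists (A : comAlgType k) (S : set A) (f : {lrmorphism A -> R}),
    [/\ finite_type A, mult_closed S & is_localization S f].

End EssentiallyFiniteType.

Section TestIdeals.
Variables (K : realType) (n p : nat) (R : comNzRingType).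
Variable a : 'I_n -> set R.

Definition test_ideal_at (c : 'I_n -> {nonneg K}) (e : nat) : set R :=
  frob_root
    (\big[@ideal_mul R/setT]_(i < n)
       ideal_exp (a i) `|Num.ceil ((c i)%:num * (p ^ e)%:R)|%N)
    (p ^ e).

Definition test_ideal (c : 'I_n -> {nonneg K}) : set R :=
  \bigcup_(e in [set e | (0 < e)%N]) test_ideal_at c e.

Definition constancy_region (c : 'I_n -> {nonneg K}) : set ('I_n -> {nonneg K}) :=
  [set c' | test_ideal c' = test_ideal c].

End TestIdeals.

Section PFractals.
Variables (K : realType) (n p : nat).

Local Notation orthant := ('I_n -> {nonneg K}).
Local Notation F := (orthant -> rat^o).

Definition box (l : 'I_n -> {posnum K}) : set orthant :=
  [set t | forall i, (t i)%:num <= (l i)%:num].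

Definition cutoff (l : 'I_n -> {posnum K}) (phi : F) : F :=
  patch (fun=> 0) (box l) phi.

Definition T_op (q : nat) (b : 'I_n -> nat) (phi : F) : F :=
  fun t => phi (fun i => (((t i)%:num + (b i)%:R) / q%:R)%:nng).

(* The T_{q|b} phi, q a power of p, are compared as functions on [0, l], extended
   by zero.  The cutoff has to come after T_{q|b}: if phi were only cut off
   before, T_{q|0} phi would have support in [0, q l] growing with q, and not even
   a nonzero constant phi would have a finite-dimensional span.  For l equal to 1
   in all coordinates this is the usual notion of p-fractal on the unit cube, and
   whenever all l_i >= 1, replacing phi by its own cutoff changes nothing
   (cutoff_T_op below). *)
Definition p_fractal_on (l : 'I_n -> {posnum K}) (phi : F) : Prop :=
  finitely_generated
    (span [set psi : F | exists (e : nat) (b : 'I_n -> nat),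
             (forall i, (b i < p ^ e)%N) /\
             psi = cutoff l (T_op (p ^ e) b phi)]).

Definition p_fractal (phi : F) : Prop := forall l, p_fractal_on l phi.

Lemma cutoff_T_op (l : 'I_n -> {posnum K}) (q : nat) (b : 'I_n -> nat) (phi : F) :
  (forall i, 1 <= (l i)%:num) -> (forall i, (b i < q)%N) ->
  cutoff l (T_op q b (cutoff l phi)) = cutoff l (T_op q b phi).
Proof.
move=> l1 bq; apply/funext => t; rewrite /cutoff /patch.
case: ifPn => // /set_mem tl; rewrite /T_op ifT//; apply/mem_set => i /=.
have q0 : (0 < q)%N by exact: leq_ltn_trans (bq i).
rewrite ler_pdivrMr ?ltr0n//.
have b1 : (b i).+1%:R <= q%:R :> K by rewrite ler_nat.
have q1 : 1 <= q%:R :> K by rewrite ler1n.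
apply: (@le_trans _ _ ((l i)%:num + (q%:R - 1))).
  by apply: lerD; [exact: tl|rewrite lerBrDr natr1].
rewrite -subr_ge0.
have -> : (l i)%:num * q%:R - ((l i)%:num + (q%:R - 1)) =
          ((l i)%:num - 1) * (q%:R - 1) :> K by ring.
by rewrite mulr_ge0 ?subr_ge0.
Qed.

End PFractals.

(* Main.v *)
Require Import Defs.
From mathcomp Require Import all_boot all_order all_algebra.
From mathcomp Require Import mathcomp_extra boolp classical_sets functions.
From mathcomp Require Import cardinality reals interval_inference zify ring.

Set Implicit Arguments.
Unset Strict Implicit.
Unset Printing Implicit Defensive.
Import Order.TTheory GRing.Theory Num.Theory.
Local Open Scope classical_set_scope.
Local Open Scope ring_scope.

(* By Kunz's theorem Frobenius on R is projective, so there are p^-1-linear maps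
   th_i and elements L_i with x = sum_i th_i(x)^p L_i; hence b^[1/p] is the ideal C(b)
   generated by the th_i(b), and test ideals are the eventual values of C^e applied to
   products of powers of the a_i.

   Finiteness: R is a ring of fractions of a quotient of a polynomial ring over the
   finite field k.  After rescaling by a unit, the th_i send degree <= D to degree
   <= D/p + G, so C turns ideals generated in degree <= D into ideals generated in
   degree <= D/p + N + G.  Hence the test ideals with exponents in a bounded box are all
   generated in one bounded degree, and since k is finite there are finitely many.

   Self-similarity: tau((t+b)/p^e) = C^e(tau(t+b)), and by Skoda's theorem tau(t+b) is
   a product of powers of the a_i, depending on b only, with tau(t + min(b,r)).  So any
   injective labelling phi of the test ideals has the property that the T_{q|b} phi, cut
   off to a box, are constant on the classes of one finite partition and take values in
   one finite set: there are only finitely many of them. *)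

(** * Ideals and Nakayama's lemma *)

(** [regular] supplies only chains of primes and a count of generators, whereas Kunz's theorem needs
    relations modulo p-th powers of parameters that can be divided. Krull's principal ideal theorem
    bridges the gap: a chain of maximal length can be rerouted through the parameters one at a time,
    and so each parameter is a nonzerodivisor modulo any mixture of other parameters and powers of
    them. This gives a Frobenius basis only locally; a dual basis replaces it globally, because the
    multipliers that admit one form an ideal. The degree filtration does not exhaust R, whose
    elements have denominators. But units do not change ideals and p-th powers of units pass through
    the th_i, so degree estimates survive the clearing of denominators. *)

Section IdealTheory.
Variable R : comNzRingType.
Implicit Types (I J N W P Q : set R) (x y z : R) (s t : seq R).

Lemma ideal0 I : ideal I -> I 0. Proof. by case. Qed.

Lemma idealD I x y : ideal I -> I x -> I y -> I (x + y).
Proof. by case=> _ h Ix Iy; have := h 1 x y Ix Iy; rewrite scale1r. Qed.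

Lemma idealMl I x y : ideal I -> I y -> I (x * y).
Proof. by case=> I0 h Iy; have := h x y 0 Iy I0; rewrite addr0. Qed.

Lemma idealMr I x y : ideal I -> I x -> I (x * y).
Proof. by move=> idI Ix; rewrite mulrC; apply: idealMl. Qed.

Lemma idealN I x : ideal I -> I x -> I (- x).
Proof. by move=> idI Ix; rewrite -mulN1r; apply: idealMl. Qed.

Lemma idealB I x y : ideal I -> I x -> I y -> I (x - y).
Proof. by move=> idI Ix Iy; apply: idealD => //; apply: idealN. Qed.

Lemma ideal_subr I x y : ideal I -> I y -> I (x - y) -> I x.
Proof. by move=> idI Iy Ixy; rewrite -(subrK y x); apply: idealD. Qed.

Lemma ideal_sum (T : Type) (r : seq T) (P : pred T) (F : T -> R) I :
  ideal I -> (forall i, P i -> I (F i)) -> I (\sum_(i <- r | P i) F i).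
Proof.
move=> idI IF; elim/big_rec: _ => [|i x Pi Ix]; first exact: ideal0.
by apply: idealD => //; exact: IF.
Qed.

Lemma mk_ideal I : I 0 -> (forall x y, I x -> I y -> I (x + y)) ->
  (forall a x, I x -> I (a * x)) -> ideal I.
Proof. by move=> I0 ID IM; split=> // a u v Iu Iv; apply: ID => //; apply: IM. Qed.

Lemma ideal_setT : ideal (@setT R).
Proof. by []. Qed.

Lemma ideal_set0 : ideal [set (0 : R)].
Proof.
by apply: mk_ideal => // [_ _ -> ->|a _ ->]; rewrite /= ?addr0 ?mulr0.
Qed.

Lemma ideal1 I : ideal I -> I 1 -> I = setT.
Proof.
move=> idI I1; rewrite predeqE => x; split=> // _.
by rewrite -(mulr1 x); apply: idealMl.
Qed.

Lemma ideal_gen_ideal (S : set R) : ideal (ideal_gen S).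
Proof.
split=> [I [idI _]|a u v Su Sv I SI]; first exact: ideal0.
by have [idI _] := SI; case: (idI) => _; apply; [exact: Su|exact: Sv].
Qed.

Lemma sub_ideal_gen (S : set R) : S `<=` ideal_gen S.
Proof. by move=> x Sx I [_]; apply. Qed.

Lemma ideal_gen_sub (S : set R) I : ideal I -> S `<=` I -> ideal_gen S `<=` I.
Proof. by move=> idI SI x; apply. Qed.

Lemma ideal_gen_mono (S S' : set R) : S `<=` S' -> ideal_gen S `<=` ideal_gen S'.
Proof.
move=> SS'; apply: ideal_gen_sub; first exact: ideal_gen_ideal.
by move=> x /SS'; apply: sub_ideal_gen.
Qed.

Lemma ideal_mul_ideal I J : ideal (ideal_mul I J).
Proof. exact: ideal_gen_ideal. Qed.

Lemma mem_ideal_mul I J x y : I x -> J y -> ideal_mul I J (x * y).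
Proof. by move=> Ix Jy; apply: sub_ideal_gen; exists x, y. Qed.

Lemma ideal_mul_sub I J W : ideal W -> (forall x y, I x -> J y -> W (x * y)) ->
  ideal_mul I J `<=` W.
Proof. by move=> idW h; apply: ideal_gen_sub => // _ [x [y [Ix Jy ->]]]; apply: h. Qed.

Lemma ideal_exp_ideal I n : ideal (ideal_exp I n).
Proof. by case: n => [|n]; [exact: ideal_setT|exact: ideal_mul_ideal]. Qed.

Lemma mem_ideal_exp I x n : I x -> ideal_exp I n (x ^+ n).
Proof. by move=> Ix; elim: n => // n ih; rewrite exprS; apply: mem_ideal_mul. Qed.

Lemma ideal_colon I x : ideal I -> ideal [set z | I (z * x)].
Proof.
move=> idI; apply: mk_ideal => /= [|y z Iy Iz|a y Iy]; rewrite ?mul0r ?mulrDl -?mulrA.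
- exact: ideal0.
- exact: idealD.
- exact: idealMl.
Qed.

Lemma ideal_preim (I : set R) x : ideal I -> ideal [set z | I (x * z)].
Proof.
move=> /(ideal_colon x); congr ideal.
by rewrite predeqE => z /=; rewrite mulrC.
Qed.

(** For ideals this is W + A z_1 + ... + A z_r. It serves twice: A = [setT] adjoins generators to an
    ideal, and a prime A = P gives the W + P N of Nakayama's lemma. *)
Fixpoint comb (A W : set R) s : set R :=
  if s is z :: s' then
    [set x | exists a y, [/\ A a, comb A W s' y & x = a * z + y]]
  else W.

Lemma comb_ideal A W s : ideal A -> ideal W -> ideal (comb A W s).
Proof.
move=> idA idW; elim: s => //= z s ih.
apply: mk_ideal => [|_ _ [a [y [Aa sy ->]]] [b [w [Ab sw ->]]]|c _ [a [y [Aa sy ->]]]].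
- by exists 0, 0; split; [exact: ideal0|exact: ideal0|rewrite mul0r addr0].
- exists (a + b), (y + w); split; [exact: idealD|exact: idealD|ring].
- exists (c * a), (c * y); split; [exact: idealMl|exact: idealMl|ring].
Qed.

Lemma sub_comb A W s : A 0 -> W `<=` comb A W s.
Proof.
move=> A0 x Wx; elim: s => //= z s ih.
by exists 0, x; split=> //; rewrite mul0r add0r.
Qed.

Lemma mem_comb A W s a z : ideal A -> ideal W -> A a -> z \in s -> comb A W s (a * z).
Proof.
move=> idA idW Aa; elim: s => //= y s ih; rewrite inE => /predU1P[->|/ih sz].
  by exists a, 0; split=> //; [exact: (ideal0 (comb_ideal s idA idW))|rewrite addr0].
by exists 0, (a * z); split=> //; [exact: ideal0|rewrite mul0r add0r].
Qed.

Lemma comb_sub A W s J : ideal J -> W `<=` J ->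
  (forall a z, A a -> z \in s -> J (a * z)) -> comb A W s `<=` J.
Proof.
move=> idJ WJ; elim: s => //= z s ih AJ _ [a [y [Aa sy ->]]].
apply: idealD => //; first by apply: AJ => //; rewrite mem_head.
by apply: ih => // b w Ab ws; apply: AJ; rewrite // inE ws orbT.
Qed.

Definition adjoin I s : set R := comb setT I s.

Lemma adjoin_ideal I s : ideal I -> ideal (adjoin I s).
Proof. exact: comb_ideal. Qed.

Lemma sub_adjoin I s : I `<=` adjoin I s.
Proof. exact: sub_comb. Qed.

Lemma mem_adjoin I s x : ideal I -> x \in s -> adjoin I s x.
Proof. by move=> idI xs; rewrite -(mul1r x); apply: mem_comb. Qed.

Lemma adjoin_sub I s J : ideal J -> I `<=` J -> (forall x, x \in s -> J x) ->
  adjoin I s `<=` J.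
Proof. by move=> idJ IJ sJ; apply: comb_sub => // a x _ /sJ; apply: idealMl. Qed.

Lemma adjoin_subset I J s t : ideal J -> I `<=` J -> {subset s <= t} ->
  adjoin I s `<=` adjoin J t.
Proof.
move=> idJ IJ st; apply: adjoin_sub; first exact: adjoin_ideal.
- by move=> x /IJ; apply: sub_adjoin.
- by move=> x /st; apply: mem_adjoin.
Qed.

Lemma eq_adjoin I s t : ideal I -> s =i t -> adjoin I s = adjoin I t.
Proof.
by move=> idI st; apply/seteqP; split; apply: adjoin_subset => // x; rewrite st.
Qed.

Lemma adjoin_cat I s t : ideal I -> adjoin I (s ++ t) = adjoin (adjoin I s) t.
Proof.
move=> idI; have idIs := adjoin_ideal s idI.
apply/seteqP; split; apply: adjoin_sub; do ?exact: adjoin_ideal.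
- by move=> x Ix; do 2!apply: sub_adjoin.
- move=> x; rewrite mem_cat => /orP[xs|]; last exact: mem_adjoin.
  by apply: sub_adjoin; apply: mem_adjoin.
- by apply: adjoin_subset => // x; rewrite mem_cat => ->.
- by move=> x xt; apply: mem_adjoin => //; rewrite mem_cat xt orbT.
Qed.

Lemma adjoin1P I x z :
  adjoin I [:: x] z <-> exists2 u, I u & exists a, z = u + a * x.
Proof.
split=> [[a [u [_ Iu ->]]]|[u Iu [a ->]]]; last by exists a, u; rewrite addrC.
by exists u => //; exists a; rewrite addrC.
Qed.

Lemma ideal_gen_adjoin s : ideal_gen [set` s] = adjoin [set 0] s.
Proof.
apply/seteqP; split.
  apply: ideal_gen_sub => [|x xs]; first exact: (adjoin_ideal s ideal_set0).
  by apply: mem_adjoin => //; exact: ideal_set0.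
apply: adjoin_sub; first exact: ideal_gen_ideal.
  by move=> _ ->; apply: ideal0; exact: ideal_gen_ideal.
by move=> x xs; apply: sub_ideal_gen.
Qed.

Lemma prime_idealE P : prime_ideal P -> ideal P. Proof. by case. Qed.

Lemma prime_idealM P x y : prime_ideal P -> ~ P x -> ~ P y -> ~ P (x * y).
Proof. by case=> _ _ h Px Py /h[]. Qed.

Lemma prime_idealX P x n : prime_ideal P -> P (x ^+ n) -> P x.
Proof.
move=> pP; elim: n => [|n ih]; first by case: pP.
by rewrite exprS; case: (pP) => _ _ /[apply] -[|/ih].
Qed.

(** Elimination in place of the determinant trick: the relation for the head z reads (u - a) z = r
    with u - a outside P, so multiplying the other relations by u - a removes z from them. *)
Lemma prime_nakayama_seq P W s : prime_ideal P -> ideal W ->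
    (forall z, z \in s -> exists2 u, ~ P u & comb P W s (u * z)) ->
  exists2 t, ~ P t & forall z, z \in s -> W (t * z).
Proof.
move=> pP idW; have idP := prime_idealE pP.
elim: s => [|z s ih] sP; first by exists 1 => //; case: pP.
have [u Pu [a [r [Pa sr ur]]]] := sP z (mem_head _ _).
have Pv : ~ P (u - a) by move=> /(ideal_subr idP Pa).
have idC := comb_ideal s idP idW.
have uz : (u - a) * z = r by rewrite mulrBl ur addrAC subrr add0r.
have [|t Pt tW] := ih.
  move=> y ys; have [|w Pw [b [c [Pb sc wc]]]] := sP y; first by rewrite inE ys orbT.
  exists ((u - a) * w); first exact: prime_idealM.
  rewrite -mulrA wc mulrDr mulrCA uz.
  by apply: idealD => //; apply: idealMl.
exists (t * (u - a)); first exact: prime_idealM.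
move=> y; rewrite inE => /predU1P[->|ys]; last first.
  by rewrite mulrAC; apply: idealMr => //; exact: tW.
rewrite -mulrA uz.
have : comb P W s `<=` [set x | W (t * x)].
  apply: comb_sub; first exact: ideal_preim.
    by move=> x Wx; apply: idealMl.
  by move=> b x _ xs /=; rewrite mulrCA; apply: idealMl => //; exact: tW.
exact.
Qed.

End IdealTheory.
Arguments ideal_set0 {R}.

(** * Noetherian induction and Krull's principal ideal theorem *)

Section Noetherian.
Variable R : comNzRingType.
Hypothesis noethR : noetherian R.
Implicit Types (I J N W P Q : set R) (x y z : R) (s t : seq R).

Lemma noetherian_adjoin I : ideal I -> exists s, I = adjoin [set 0] s.
Proof. by move=> /noethR[s ->]; exists s; rewrite -ideal_gen_adjoin. Qed.

Lemma noetherian_ind (T : set R -> Prop) :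
  (forall I, ideal I -> (forall J, ideal J -> I `<` J -> T J) -> T I) ->
  forall I, ideal I -> T I.
Proof.
move=> Tind I0 idI0; apply: contrapT => TI0.
have [|A [PA maxA]] := @Zorn_bigcup R [set I | I = set0 \/ ideal I /\ ~ T I].
  move=> F FP totF.
  have [[X0 FX0 [x0 X0x0]]|F0] := pselect (exists2 X, F X & X !=set0); last first.
    left; rewrite predeqE => x; split=> // -[X FX Xx].
    by apply: F0; exists X => //; exists x.
  have FI X x : F X -> X x -> ideal X /\ ~ T X.
    by move=> /FP[->|].
  have idU : ideal (\bigcup_(X in F) X).
    apply: mk_ideal => [|x y [X FX Xx] [Y FY Yy]|a x [X FX Xx]].
    - by exists X0 => //; apply: ideal0; case: (FI X0 x0).
    - have [idX _] := FI _ _ FX Xx; have [idY _] := FI _ _ FY Yy.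
      have [XY|YX] := totF X Y FX FY.
        by exists Y => //; apply: idealD => //; apply: XY.
      by exists X => //; apply: idealD => //; apply: YX.
    - by exists X => //; apply: idealMl => //; case: (FI _ _ FX Xx).
  have [s Us] := noetherian_adjoin idU.
  have [X FX sX] : exists2 X, F X & forall x, x \in s -> X x.
    have : forall x, x \in s -> (\bigcup_(X in F) X) x.
      by move=> x xs; rewrite Us; apply: mem_adjoin => //; exact: ideal_set0.
    elim: (s) => [|x r ih] rU; first by exists X0.
    have [|X FX rX] := ih; first by move=> y yr; apply: rU; rewrite inE yr orbT.
    have [Y FY Yx] := rU x (mem_head _ _).
    have [XY|YX] := totF X Y FX FY.
      by exists Y => // y; rewrite inE => /predU1P[->//|/rX/XY].
    by exists X => // y; rewrite inE => /predU1P[->|/rX//]; exact: YX.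
  have [X00|[idX TX]] := FP _ FX.
    case: (totF X X0 FX FX0) => [_|]; last by rewrite X00 => /(_ _ X0x0).
    right; split=> // TU; apply: (FI X0 x0 FX0 X0x0).2.
    suff -> : X0 = \bigcup_(X in F) X by [].
    apply/seteqP; split=> [x X0x|]; first by exists X0.
    rewrite Us; apply: adjoin_sub; first by case: (FI X0 x0).
      by move=> _ ->; apply: ideal0; case: (FI X0 x0).
    by move=> x /sX; rewrite X00.
  suff -> : \bigcup_(X in F) X = X by right.
  apply/seteqP; split=> [|x Xx]; last by exists X.
  by rewrite Us; apply: adjoin_sub => // _ ->; exact: ideal0.
have [A0|[idA TA]] := PA.
  apply: (maxA I0); last by right.
  by rewrite A0; split=> // /(_ _ (ideal0 idI0)).
apply: TA; apply: Tind => // J idJ AJ; apply: contrapT => TJ.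
by apply: (maxA J) => //; right.
Qed.

Lemma exists_maximal I : ideal I -> ~ I 1 -> exists2 m, maximal_ideal m & I `<=` m.
Proof.
move: I; apply: noetherian_ind => I idI ih I1.
have [maxI|] := pselect (maximal_ideal I); first by exists I.
move=> nmaxI; have [J [idJ J1 IJ nJI]] : exists J, [/\ ideal J, ~ J 1, I `<=` J & J <> I].
  apply: contrapT => nex; apply: nmaxI; split=> // J idJ J1 IJ.
  by apply: contrapT => nJI; apply: nex; exists J.
have [|m maxm Jm] := ih J idJ _ J1; last by exists m => // x /IJ/Jm.
by split=> // JI; apply: nJI; apply/seteqP.
Qed.

(* Nakayama's lemma over the localization at P, with denominators cleared. *)
Lemma prime_nakayama P W N : prime_ideal P -> ideal W -> ideal N ->
    (forall z, N z -> exists u w, [/\ ~ P u, W w & ideal_mul P N (u * z - w)]) ->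
  exists2 t, ~ P t & forall z, N z -> W (t * z).
Proof.
move=> pP idW idN NP; have [s Ns] := noetherian_adjoin idN.
have idP := prime_idealE pP; have idC := comb_ideal s idP idW.
have sN z : z \in s -> N z.
  by move=> zs; rewrite Ns; apply: mem_adjoin => //; exact: ideal_set0.
have [|t Pt sW] := @prime_nakayama_seq _ P W s pP idW.
  move=> z /sN/NP[u [w [Pu Ww uzw]]]; exists u => //.
  apply: (ideal_subr idC (sub_comb s (ideal0 idP) Ww)).
  move: uzw; apply: ideal_mul_sub => // x y Px.
  rewrite Ns; have : adjoin [set 0] s `<=` [set y | comb P W s (x * y)].
    apply: adjoin_sub; first exact: ideal_preim.
      by move=> _ ->; rewrite /= mulr0; apply: ideal0.
    by move=> b bs; exact: mem_comb.
  exact.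
exists t => // z; rewrite Ns.
have : adjoin [set 0] s `<=` [set y | W (t * y)].
  apply: adjoin_sub; [exact: ideal_preim| |by move=> b /sW].
  by move=> _ ->; rewrite /= mulr0; apply: ideal0.
exact.
Qed.

(* If P is minimal over I0 then R_P/I0 is Artinian. *)
Lemma dcc_at_minimal_prime P I0 : prime_ideal P ->
    (forall Q, prime_ideal Q -> I0 `<=` Q -> Q `<=` P -> Q = P) ->
  forall I, ideal I -> I0 `<=` I -> forall J : nat -> set R,
    (forall n, ideal (J n)) -> (forall n, I `<=` J n) ->
    (forall m n, (m <= n)%N -> J n `<=` J m) ->
  exists n, forall m, (n <= m)%N -> forall z, J n z -> exists2 u, ~ P u & J m (u * z).
Proof.
move=> pP minP; have idP := prime_idealE pP.
apply: noetherian_ind => I idI ih I0I J idJ IJ decJ.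
have [IP|] := pselect (I `<=` P); last first.
  move=> /existsNP[u /not_implyP[Iu Pu]]; exists 0%N => m _ z _.
  by exists u => //; apply: idealMr => //; exact: IJ.
have [pI|npI] := pselect (prime_ideal I).
  have IPe : I = P by exact: minP.
  have [[n JP]|nJP] := pselect (exists n, J n `<=` P).
    exists n => m nm z /JP Pz; exists 1; first by case: pP.
    by rewrite mul1r; apply: IJ; rewrite IPe.
  exists 0%N => m _ z _; have /existsNP[u /not_implyP[Ju Pu]] : ~ J m `<=` P.
    by move=> JP; apply: nJP; exists m.
  by exists u => //; apply: idealMr.
(* A non-prime I is enlarged in two ways, to I + (a) and to (I : a), which contains b. Up to
   denominators outside P, the chain J is stationary once J + (a) and (J : a) are. *)
have [a [b [Iab Ia Ib]]] : exists a b, [/\ I (a * b), ~ I a & ~ I b].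
  apply: contrapT => nex; apply: npI; split=> // [/IP|x y Ixy]; first by case: pP.
  by apply: contrapT => /not_orP[Ix Iy]; apply: nex; exists x, y.
have [|||||n1 h1] := ih (adjoin I [:: a]) (adjoin_ideal _ idI) _ _
    (fun n => adjoin (J n) [:: a]).
- split; first exact: sub_adjoin.
  by move=> /(_ a); rewrite /= => h; apply: Ia; apply: h; apply: mem_adjoin; rewrite ?inE.
- by move=> x /I0I; apply: sub_adjoin.
- by move=> n; apply: adjoin_ideal.
- by move=> n; apply: adjoin_subset.
- by move=> m n mn; apply: adjoin_subset => //; exact: decJ.
have [|||||n2 h2] := ih [set z | I (z * a)] (ideal_colon a idI) _ _
    (fun n => [set z | J n (z * a)]).
- split; first by move=> x Ix; apply: idealMr.
  by move=> /(_ b) h; apply: Ib; apply: h; rewrite /= mulrC.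
- by move=> x /I0I Ix; apply: idealMr.
- by move=> n; apply: ideal_colon.
- by move=> n x /(IJ n).
- by move=> m n mn x /=; apply: decJ.
exists (maxn n1 n2) => m; rewrite geq_max => /andP[n1m n2m] z Jz.
have [//||u Pu /adjoin1P[w Jw [r uzr]]] := h1 m _ z.
  by apply: sub_adjoin; apply: decJ Jz; rewrite leq_maxl.
have Jra : J n2 (r * a).
  rewrite (_ : r * a = u * z - w); last by rewrite uzr addrAC subrr add0r.
  apply: idealB => //; last exact: decJ Jw.
  by apply: idealMl => //; apply: decJ Jz; rewrite leq_maxr.
have [//|v Pv /= Jvr] := h2 m _ r Jra.
exists (v * u); first exact: prime_idealM.
by rewrite -mulrA uzr mulrDr mulrA; apply: idealD => //; apply: idealMl.
Qed.

(* Krull's principal ideal theorem, in the form needed to move chains of primes: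
   if P2 were minimal over P0 + (x), the symbolic powers of P1 modulo P0 + (x)
   would stabilise at P2, and Nakayama would give P1 = P0. *)
Lemma prime_between P0 P1 P2 x : prime_ideal P0 -> prime_ideal P1 -> prime_ideal P2 ->
    P0 `<` P1 -> P1 `<` P2 -> P2 x ->
  exists P', [/\ prime_ideal P', P0 `<` P', P' `<` P2 & P' x].
Proof.
move=> pP0 pP1 pP2 P01 P12 P2x; apply: contrapT => nex.
have idP0 := prime_idealE pP0; have idP1 := prime_idealE pP1.
have P1x : ~ P1 x by move=> P1x; apply: nex; exists P1.
have P0x : ~ P0 x by move=> /P01.1.
have minP2 Q : prime_ideal Q -> adjoin P0 [:: x] `<=` Q -> Q `<=` P2 -> Q = P2.
  move=> pQ P0Q QP2; apply: contrapT => nQ; apply: nex; exists Q.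
  have Qx : Q x by apply: P0Q; apply: mem_adjoin; rewrite ?inE.
  split=> //; first by split=> [y /(@sub_adjoin _ P0 [:: x])/P0Q|/(_ _ Qx)].
  by split=> // P2Q; apply: nQ; apply/seteqP.
(* [pw n] is P0 + P1^n, and [sp n] below contracts it from the localization at P1: the symbolic
   powers of P1 modulo P0. *)
pose pw n := [set z | exists2 u, P0 u & ideal_exp P1 n (z - u)].
have id_pw n : ideal (pw n).
  have idE := ideal_exp_ideal P1 n.
  apply: mk_ideal => [|y z [u P0u yu] [v P0v zv]|a y [u P0u yu]].
  - by exists 0; [exact: ideal0|rewrite subrr; exact: ideal0].
  - by exists (u + v); [exact: idealD|rewrite opprD addrACA; exact: idealD].
  - by exists (a * u); [exact: idealMl|rewrite -mulrBr; exact: idealMl].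
pose sp n := [set z | exists2 u, ~ P1 u & pw n (u * z)].
have id_sp n : ideal (sp n).
  apply: mk_ideal => [|y z [u P1u yu] [v P1v zv]|a y [u P1u yu]].
  - by exists 1; [case: pP1|rewrite mulr0; exact: ideal0].
  - exists (u * v); first exact: prime_idealM.
    rewrite mulrDr {1}[u * v]mulrC -!mulrA.
    by apply: idealD => //; apply: idealMl.
  - by exists u => //; rewrite mulrCA; apply: idealMl.
have pw_sp n : pw n `<=` sp n.
  by move=> z pz; exists 1; [case: pP1|rewrite mul1r].
have decS n : sp n.+1 `<=` sp n.
  move=> z [u P1u [v P0v uzv]]; exists u => //; exists v => //.
  move: uzv; apply: ideal_mul_sub; first exact: ideal_exp_ideal.
  by move=> a b _; apply: idealMl; exact: ideal_exp_ideal.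
have decSs m n : (m <= n)%N -> sp n `<=` sp m.
  by move=> /subnKC <-; elim: (n - m)%N => [|k ih]; rewrite ?addn0// addnS => z /decS/ih.
have [||||n hn] := dcc_at_minimal_prime pP2 minP2 (adjoin_ideal [:: x] idP0) _
    (J := fun n => adjoin (sp n) [:: x]).
- by [].
- by move=> n; apply: adjoin_ideal.
- move=> n; apply: adjoin_subset => // z P0z; apply: pw_sp; exists z => //.
  by rewrite subrr; apply: ideal0; exact: ideal_exp_ideal.
- by move=> m n mn; apply: adjoin_subset => //; exact: decSs.
have [|t P2t tS] := prime_nakayama pP2 (id_sp n.+1) (id_sp n).
  move=> z Sz; have [||u P2u /adjoin1P[w Sw [r uzr]]] := hn n.+1 _ z.
  - by [].
  - exact: sub_adjoin.
  exists u, w; split=> //.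
  have -> : u * z - w = x * r by rewrite uzr addrAC subrr add0r mulrC.
  apply: mem_ideal_mul => //.
  (* As x is outside P1, r x in [sp n] gives r in [sp n]. Hence u z - w = x r lies in P2 times
     [sp n], as Nakayama at P2 demands. *)
  have [v P1v Srx] : sp n (r * x).
    rewrite (_ : r * x = u * z - w); last by rewrite uzr addrAC subrr add0r.
    by apply: idealB => //; [exact: idealMl|exact: decS].
  exists (v * x); first exact: prime_idealM.
  by rewrite -mulrA [x * _]mulrC.
have Sn z : sp n z -> sp n.+1 z.
  move=> /tS[u P1u]; rewrite mulrA => h; exists (u * t) => //.
  by apply: prime_idealM => // /P12.1.
(* Now Nakayama at P1: up to denominators outside P1, P1^n lies in P0 + P1 P1^n, so some v outside
   P1 carries P1^n into P0. *)
have [|v P1v vP0] := prime_nakayama pP1 idP0 (ideal_exp_ideal P1 n).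
  move=> z Ez; have [|u P1u [w P0w uzw]] := Sn z.
    by apply: pw_sp; exists 0; [exact: ideal0|rewrite subr0].
  by exists u, w; split.
case: P01 => P01; apply=> y P1y; apply: (@prime_idealX _ _ _ n) => //.
have := vP0 _ (mem_ideal_exp n P1y).
by case: (pP0) => _ _ /[apply] -[/P01|].
Qed.

End Noetherian.

(** * Regular local rings *)

Section RegularLocal.
Variable R : comNzRingType.
Hypothesis noethR : noetherian R.
Implicit Types (I K P Q m : set R) (x y z : R) (s t : seq R).

Lemma maximal_prime m : maximal_ideal m -> prime_ideal m.
Proof.
move=> [idm m1 maxm]; split=> // x y mxy.
have [mx|mx] := pselect (m x); [by left|right].
have idmx := adjoin_ideal [:: x] idm.
have : adjoin m [:: x] 1.
  apply: contrapT => /(maxm _ idmx)/(_ (@sub_adjoin _ m _)) eqm.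
  by apply: mx; rewrite -eqm; apply: mem_adjoin; rewrite ?inE.
move=> /adjoin1P[u mu [a e1]].
by rewrite -[y]mul1r e1 mulrDl -mulrA; apply: idealD => //; [exact: idealMr|exact: idealMl].
Qed.

Lemma local_unit m x : local_with m -> ~ m x -> exists y, x * y = 1.
Proof.
move=> [_ locm] mx; have [|Rx1] := pselect (adjoin [set 0] [:: x] 1).
  by move=> /adjoin1P[_ -> [y ->]]; exists y; rewrite add0r mulrC.
have [M maxM RxM] := exists_maximal noethR (adjoin_ideal _ ideal_set0) Rx1.
by case: mx; rewrite -(locm M maxM); apply/RxM/mem_adjoin; rewrite ?inE//; apply: ideal_set0.
Qed.

Lemma local_nakayama m W N : local_with m -> ideal W -> ideal N ->
    (forall z, N z -> exists2 w, W w & ideal_mul m N (z - w)) -> N `<=` W.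
Proof.
move=> locm idW idN NW z Nz.
have pm := maximal_prime locm.1.
have [|t mt tW] := prime_nakayama noethR pm idW idN.
  by move=> y /NW[w Ww h]; exists 1, w; split=> //; [case: pm|rewrite mul1r].
have [u tu] := local_unit locm mt.
by rewrite -[z]mul1r -tu mulrAC; apply: idealMr => //; exact: tW.
Qed.

(** A recursive form of [has_prime_chain] with both ends visible, so that a chain can be altered one
    member at a time. *)
Fixpoint prime_chain l P Q :=
  prime_ideal P /\
  (if l is l'.+1 then exists2 P', P `<` P' & prime_chain l' P' Q else P = Q).

Lemma has_prime_chainW l : has_prime_chain R l -> exists P Q, prime_chain l P Q.
Proof.
case=> P [pP ltP].
have h j : forall i (il : (i < l.+1)%N), (l - i)%N = j ->
    prime_chain j (P (Ordinal il)) (P ord_max).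
  elim: j => [|j ih] i il lij; split=> //.
    by congr P; apply/val_inj => /=; lia.
  have i1l : (i.+1 < l.+1)%N by lia.
  by exists (P (Ordinal i1l)); [exact: ltP|apply: ih; lia].
by exists (P (Ordinal (ltn0Sn l))), (P ord_max); apply: h; rewrite subn0.
Qed.

Lemma prime_chain_prime l P Q : prime_chain l P Q -> prime_ideal P.
Proof. by case: l => [|l] []. Qed.

Lemma prime_chain_sub l P Q : prime_chain l P Q -> P `<=` Q.
Proof.
by elim: l P => /= [P [_ ->]//|l ih P [_ [P' [PP' _] /ih P'Q]]] x /PP'/P'Q.
Qed.

Lemma prime_chain_last l P Q : prime_chain l P Q -> prime_ideal Q.
Proof. by elim: l P => /= [P [+ <-]//|l ih P [_ [P' _ /ih]]]. Qed.

Lemma prime_chain_rcons l P Q Q' : prime_chain l P Q -> prime_ideal Q' -> Q `<` Q' ->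
  prime_chain l.+1 P Q'.
Proof.
move=> + pQ' QQ'; elim: l P => /= [P [pP ePQ]|l ih P [pP [P' PP' /ih h]]]; last by split=> //; exists P'.
by split=> //; exists Q' => //; rewrite ePQ.
Qed.

(** An element of the top prime is moved down: [prime_between] replaces members of the chain by
    primes containing x, until only the bottom is left as it was. *)
Lemma prime_chain_through l P Q x : prime_chain l.+1 P Q -> Q x ->
  exists P', [/\ P `<` P', P' x & prime_chain l P' Q].
Proof.
move=> + Qx; elim: l P => [|l ih] P.
  by case=> pP [P' PP' [pP' P'Q]]; exists P'; split=> //; rewrite P'Q.
case=> pP [P1 PP1 cP1]; have [P2 [P12 P2x cP2]] := ih P1 cP1.
have [P' [pP' PP' P'P2 P'x]] :=
  prime_between noethR pP cP1.1 (prime_chain_prime cP2) PP1 P12 P2x.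
by exists P'; split=> //; split=> //; exists P2.
Qed.

(** Krull's height bound over I: routing the chain through the first generator and dropping the
    bottom member trades one generator for one step. *)
Lemma prime_chain_size m I s l P : ideal I -> m = adjoin I s -> I `<=` P ->
  prime_chain l P m -> (l <= size s)%N.
Proof.
elim: s l I P => [|x s ih] [|l] I P idI mE IP //.
  by case=> _ [P' [_ P'P] /prime_chain_sub]; rewrite mE => /subset_trans/(_ IP).
have mx : m x by rewrite mE; apply: mem_adjoin; rewrite // mem_head.
move=> /prime_chain_through/(_ mx)[P' [[PP' _] P'x cP']].
apply: (ih l (adjoin I [:: x]) P') => //; first exact: adjoin_ideal.
  by rewrite -adjoin_cat.
apply: adjoin_sub; first exact: prime_idealE (prime_chain_prime cP').
  by move=> z /IP/PP'.
by move=> z; rewrite inE => /eqP->.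
Qed.

(** The extremal case of the height bound. By induction I + (x) is the next prime, and x is outside
    P, so every element of P lies in I + x P; Nakayama gives P = I. *)
Lemma prime_chain_bottom m I s P : local_with m -> ideal I -> m = adjoin I s -> I `<=` P ->
  prime_chain (size s) P m -> I = P.
Proof.
move=> locm; elim: s I P => [|x s ih] I P idI mE IP.
  by case=> _ ->; rewrite mE.
have mx : m x by rewrite mE; apply: mem_adjoin; rewrite // mem_head.
move=> cP; have idP := prime_idealE (prime_chain_prime cP).
have [P' [[PP' P'P] P'x cP']] := prime_chain_through cP mx.
have idP' := prime_idealE (prime_chain_prime cP').
have IP' : adjoin I [:: x] `<=` P'.
  by apply: adjoin_sub => // [z /IP/PP'//|z]; rewrite inE => /eqP->.
have IxE : adjoin I [:: x] = P'.
  by apply: ih; [exact: adjoin_ideal|rewrite -adjoin_cat| |].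
have Px : ~ P x.
  move=> Px; apply: P'P; rewrite -IxE; apply: adjoin_sub => // z.
  by rewrite inE => /eqP->.
apply/seteqP; split=> //; apply: (local_nakayama locm) => // z Pz.
have : adjoin I [:: x] z by rewrite IxE; exact: PP'.
move=> /adjoin1P[u Iu [a ze]]; exists u => //.
rewrite ze addrAC subrr add0r mulrC; apply: mem_ideal_mul => //.
have : P (a * x) by rewrite (_ : a * x = z - u); [apply: idealB => //; exact: IP|rewrite ze; ring].
by case: (prime_chain_prime cP) => _ _ /[apply] -[].
Qed.

(** The extremal case applies again after each generator of [s1] is adjoined, which makes the ideal
    of [s1] prime. If it contained y, fewer generators than steps would remain. *)
Lemma prime_chain_regular m I s1 y s2 P : local_with m -> ideal I ->
  m = adjoin I (s1 ++ y :: s2) -> I `<=` P -> prime_chain (size (s1 ++ y :: s2)) P m ->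
  prime_ideal (adjoin I s1) /\ ~ adjoin I s1 y.
Proof.
move=> locm; elim: s1 I P => [|x s ih] I P idI mE IP cP.
  have IPe := prime_chain_bottom locm idI mE IP cP.
  split; first by rewrite /adjoin /= IPe; exact: prime_chain_prime cP.
  move=> Iy; suff : (size (y :: s2) <= size s2)%N by rewrite ltnn.
  apply: (prime_chain_size idI _ IP cP); rewrite mE.
  apply/seteqP; split.
    apply: adjoin_sub; [exact: adjoin_ideal|exact: sub_adjoin|move=> z].
    by rewrite inE => /predU1P[->|zs]; [exact: sub_adjoin|exact: mem_adjoin].
  by apply: adjoin_subset => // z zs; rewrite inE zs orbT.
have mx : m x by rewrite mE; apply: mem_adjoin; rewrite // mem_head.
have [P' [[PP' P'P] P'x cP']] := prime_chain_through cP mx.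
have idP' := prime_idealE (prime_chain_prime cP').
rewrite -cat1s adjoin_cat//; apply: (ih _ P') => //; first exact: adjoin_ideal.
  by rewrite -adjoin_cat.
by apply: adjoin_sub => // [z /IP/PP'//|z]; rewrite inE => /eqP->.
Qed.

(** Induction on n: if z = k' + w x^n, cancelling x^n in the relation for y z puts y w, hence w, in
    K + (x). *)
Lemma nonzerodivisor_adjoin_exp K x y n : ideal K ->
    (forall z, K (x * z) -> K z) ->
    (forall z, adjoin K [:: x] (y * z) -> adjoin K [:: x] z) ->
  forall z, adjoin K [:: x ^+ n] (y * z) -> adjoin K [:: x ^+ n] z.
Proof.
move=> idK xK yK; elim: n => [|n ih] z.
  move=> _; rewrite -[z]mulr1; apply: idealMl; first exact: adjoin_ideal.
  by apply: mem_adjoin; rewrite // inE.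
move=> /adjoin1P[k Kk [r yz]].
have /adjoin1P[k' Kk' [w zw]] : adjoin K [:: x ^+ n] z.
  by apply: ih; apply/adjoin1P; exists k => //; exists (r * x); rewrite yz exprS mulrA.
have xnK v : K (x ^+ n * v) -> K v.
  by elim: (n) => [|j ihj]; rewrite ?mul1r// exprS -mulrA => /xK.
have /yK/adjoin1P[k2 Kk2 [c wc]] : adjoin K [:: x] (y * w).
  apply/adjoin1P; exists (y * w - r * x); last by exists r; rewrite subrK.
  apply: xnK; rewrite (_ : _ * _ = k - y * k'); first by apply: idealB => //; exact: idealMl.
  have : y * z = y * k' + x ^+ n * (y * w) by rewrite zw; ring.
  rewrite yz exprS => e.
  have -> : k = y * k' + x ^+ n * (y * w) - r * (x * x ^+ n) by rewrite -e addrK.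
  ring.
apply/adjoin1P; exists (k' + k2 * x ^+ n); first by apply: idealD => //; exact: idealMr.
by exists c; rewrite zw wc exprS; ring.
Qed.

(** All orderings of the parameters are included, because replacing some of them by powers requires
    any of them to be brought to the front. *)
Definition regular_system m s :=
  [/\ local_with m, m = adjoin [set 0] s &
      forall s1 y s2, perm_eq s (s1 ++ y :: s2) ->
        prime_ideal (adjoin [set 0] s1) /\ ~ adjoin [set 0] s1 y].

(** Induction on [s2], whose head x enters as x^q. By [nonzerodivisor_adjoin_exp] it suffices to
    treat x itself modulo the rest, and y with x moved to [s1]. The list [s3] holds the parameters
    left out. *)
Lemma regular_system_nonzerodivisor m s q s1 s2 s3 y : regular_system m s ->
  perm_eq s (y :: s1 ++ s2 ++ s3) ->
  let J := adjoin [set 0] (s1 ++ map (fun x => x ^+ q) s2) in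
  forall z, J (y * z) -> J z.
Proof.
move=> [_ _ regs]; elim: s2 s1 s3 y => [|x s2 ih] s1 s3 y sE J z; rewrite /J.
  have [pJ Jy] : prime_ideal (adjoin [set 0] s1) /\ ~ adjoin [set 0] s1 y.
    apply: (regs s1 y s3); rewrite (perm_trans sE)// perm_sym -cat1s perm_catCA.
    by rewrite cat1s.
  by rewrite cats0; case: pJ => _ _ /[apply] -[].
pose K := adjoin [set 0] (s1 ++ map (fun x => x ^+ q) s2).
have idK : ideal K by apply: adjoin_ideal; exact: ideal_set0.
rewrite (_ : adjoin _ _ = adjoin K [:: x ^+ q]); last first.
  rewrite -adjoin_cat; last exact: ideal_set0.
  apply: eq_adjoin; first exact: ideal_set0.
  by move=> v; rewrite /= !mem_cat !inE !orbA [(v \in s1) || _]orbC -!orbA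
    [_ || (v == _)]orbC orbA [_ || (v \in s1)]orbC -orbA; do !case: (_ \in _); case: (_ == _).
apply: nonzerodivisor_adjoin_exp => //.
  apply: (ih s1 (y :: s3) x).
  by rewrite (perm_trans sE)//; apply/permP => a; rewrite /= !count_cat /= !count_cat /=; lia.
move=> w; rewrite (_ : adjoin K _ = adjoin [set 0] ((x :: s1) ++ map (fun x => x ^+ q) s2)).
  apply: (ih (x :: s1) s3 y).
  by rewrite (perm_trans sE)//; apply/permP => a; rewrite /= !count_cat /= !count_cat /=; lia.
rewrite -adjoin_cat; last exact: ideal_set0.
apply: eq_adjoin; first exact: ideal_set0.
by move=> v; rewrite /= !(mem_cat, inE) orbC.
Qed.

Lemma regular_systemP m (d : nat) (x : d.-tuple R) :
  local_with m -> krull_dim_eq R d -> m = ideal_gen [set` x] -> regular_system m x.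
Proof.
move=> locm [cd _] mE; have pm := maximal_prime locm.1.
have mx : m = adjoin [set 0] x by rewrite mE ideal_gen_adjoin.
(* A chain of length d must end at m: otherwise appending m would give d + 1 steps, against the
   height bound for d generators. *)
have [P cP] : exists P, prime_chain d P m.
  have [P [Q cPQ]] := has_prime_chainW cd.
  have pQ := prime_chain_last cPQ; have idQ := prime_idealE pQ.
  have [|M maxM QM] := exists_maximal noethR idQ; first by case: pQ.
  have {maxM}Mm := locm.2 _ maxM; rewrite {}Mm in QM.
  have [mQ|mQ] := pselect (m `<=` Q).
    by exists P; rewrite (_ : m = Q)//; apply/seteqP.
  suff : (d.+1 <= size x)%N by rewrite size_tuple ltnn.
  apply: (@prime_chain_size m [set 0] x _ P ideal_set0 mx).
    by move=> _ ->; apply: ideal0; exact: prime_idealE (prime_chain_prime cPQ).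
  exact: prime_chain_rcons cPQ pm _.
split=> // s1 y s2 xE; apply: (@prime_chain_regular m _ _ _ s2 P) => //.
- exact: ideal_set0.
- by rewrite mx; apply: eq_adjoin; [exact: ideal_set0|exact: perm_mem].
- by move=> _ ->; apply: ideal0; exact: prime_idealE (prime_chain_prime cP).
- by rewrite -(perm_size xE) size_tuple.
Qed.

End RegularLocal.

(** * Kunz's theorem *)

Section FrobeniusSpan.
Variables (R : comNzRingType) (p : nat).
Hypothesis charp : p \in [pchar R].
Implicit Types (x y z : R) (s g : seq R) (c : nat -> R).

Lemma pchar_exprD x y : (x + y) ^+ p = x ^+ p + y ^+ p.
Proof. by rewrite -!(pFrobenius_autE charp) rmorphD. Qed.

Lemma pchar_exprN x : (- x) ^+ p = - x ^+ p.
Proof. by rewrite -!(pFrobenius_autE charp) rmorphN. Qed.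

Lemma pchar_expr0 : 0 ^+ p = 0 :> R.
Proof. by rewrite -!(pFrobenius_autE charp) rmorph0. Qed.

Lemma adjoin_frob s x : adjoin [set 0] s x -> adjoin [set 0] (map (fun y => y ^+ p) s) (x ^+ p).
Proof.
elim: s x => [|y s ih] x /=; first by move=> ->; rewrite pchar_expr0.
move=> [a [r [_ sr ->]]]; exists (a ^+ p), (r ^+ p); split=> //; first exact: ih.
by rewrite pchar_exprD exprMn.
Qed.

Definition frob_lin s c : R := \sum_(i < size s) c i ^+ p * s`_i.

Definition frob_span s : set R := [set z | exists c, z = frob_lin s c].

Lemma frob_linD s c d : frob_lin s (fun i => c i + d i) = frob_lin s c + frob_lin s d.
Proof.
rewrite /frob_lin -big_split /=; apply: eq_bigr => i _.
by rewrite pchar_exprD mulrDl.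
Qed.

Lemma frob_linZ s a c : frob_lin s (fun i => a * c i) = a ^+ p * frob_lin s c.
Proof.
by rewrite /frob_lin mulr_sumr; apply: eq_bigr => i _; rewrite exprMn mulrA.
Qed.

Lemma frob_lin_sum s (T : Type) (r : seq T) (a : T -> R) (d : T -> nat -> R) :
  frob_lin s (fun j => \sum_(i <- r) a i * d i j) = \sum_(i <- r) a i ^+ p * frob_lin s (d i).
Proof.
elim: r => [|i r ih].
  rewrite big_nil /frob_lin big1// => j _.
  by rewrite big_nil pchar_expr0 mul0r.
rewrite big_cons -ih -frob_linZ -frob_linD; congr (frob_lin s _).
by apply/funext => j; rewrite big_cons.
Qed.

Lemma frob_linN s c : frob_lin s (fun i => - c i) = - frob_lin s c.
Proof.
by rewrite /frob_lin -sumrN; apply: eq_bigr => i _; rewrite pchar_exprN mulNr.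
Qed.

Lemma frob_lin0 s : frob_lin s (fun=> 0) = 0.
Proof. by rewrite /frob_lin big1// => i _; rewrite pchar_expr0 mul0r. Qed.

Lemma frob_lin_delta s j : (j < size s)%N -> frob_lin s (fun i => (i == j)%:R) = s`_j.
Proof.
move=> js; rewrite /frob_lin (bigD1 (Ordinal js))//= eqxx expr1n mul1r big1 ?addr0// => i.
by rewrite -val_eqE /= => /negPf->; rewrite pchar_expr0 mul0r.
Qed.

Lemma frob_span0 s : frob_span s 0.
Proof. by exists (fun=> 0); rewrite frob_lin0. Qed.

Lemma frob_spanD s x y : frob_span s x -> frob_span s y -> frob_span s (x + y).
Proof. by move=> [c ->] [d ->]; exists (fun i => c i + d i); rewrite frob_linD. Qed.

Lemma frob_spanZ s a x : frob_span s x -> frob_span s (a ^+ p * x).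
Proof. by move=> [c ->]; exists (fun i => a * c i); rewrite frob_linZ. Qed.

Lemma frob_span_trans s s' : (forall i, (i < size s)%N -> frob_span s' s`_i) ->
  frob_span s `<=` frob_span s'.
Proof.
move=> ss' _ [c ->]; rewrite /frob_lin; elim/big_rec: _ => [|i z _ zs'].
  exact: frob_span0.
by apply: frob_spanD => //; apply: frob_spanZ; exact: ss'.
Qed.

Lemma frob_span_nth s j : (j < size s)%N -> frob_span s s`_j.
Proof. by move=> /frob_lin_delta <-; eexists. Qed.

(** Only lists drawn from [g] compete. This keeps a basis of a localization among the images of
    elements of the original ring, so that it can be lifted. *)
Lemma exists_minimal_frob_span g : frob_span g = setT -> exists s,
  [/\ {subset s <= g}, frob_span s = setT &
      forall s', {subset s' <= g} -> frob_span s' = setT -> (size s <= size s')%N].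
Proof.
move=> gT.
pose T n := `[< exists s, [/\ {subset s <= g}, frob_span s = setT & size s = n] >].
have exT : exists n, T n by exists (size g); apply/asboolP; exists g; split.
case: (ex_minnP exT) => n /asboolP[s [sg sT sn]] minn.
exists s; split=> // s' s'g s'T; rewrite sn; apply: minn.
by apply/asboolP; exists s'.
Qed.

Variables (m : set R) (x : seq R).
Hypotheses (noethR : noetherian R) (regx : regular_system m x).

Let locm : local_with m. Proof. by case: regx. Qed.
Let idm : ideal m. Proof. by case: locm => -[]. Qed.
Let xm y : y \in x -> m y.
Proof. by case: regx => _ -> _ xy; apply: mem_adjoin => //; exact: ideal_set0. Qed.
Local Notation frob_seq := (map (fun y => y ^+ p)).

Lemma frob_lin_maximal_coef s z : frob_span s = setT -> adjoin [set 0] (frob_seq x) z ->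
  exists2 c, z = frob_lin s c & forall i, m (c i).
Proof.
move=> sT.
suff h t : {subset t <= x} -> forall y, adjoin [set 0] (frob_seq t) y ->
    exists2 c, y = frob_lin s c & forall i, m (c i) by exact: h.
elim: t {z} => [|y t ih] tx z /=.
  by move=> ->; exists (fun=> 0); rewrite ?frob_lin0// => _; exact: ideal0.
have {}ih := ih (fun w wt => tx w (mem_behead (s := y :: t) wt)).
move=> [a [r [_ /ih[c -> mc] ->]]].
have [d ->] : frob_span s a by rewrite sT.
exists (fun i => y * d i + c i); first by rewrite frob_linD frob_linZ mulrC.
move=> i; apply: idealD => //; apply: idealMr => //.
by apply: xm; apply: tx; rewrite mem_head.
Qed.

(** If c j were outside m, subtracting a representation with coefficients in m would leave a
    relation whose j-th coefficient is a unit, and the j-th entry of [s] could be dropped. *)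
Lemma minimal_frob_span_coef g s c : {subset s <= g} -> frob_span s = setT ->
    (forall s', {subset s' <= g} -> frob_span s' = setT -> (size s <= size s')%N) ->
    adjoin [set 0] (frob_seq x) (frob_lin s c) ->
  forall j, (j < size s)%N -> m (c j).
Proof.
move=> sg sT mins cx j js; apply: contrapT => mcj.
have [d cd md] := frob_lin_maximal_coef sT cx.
pose e i := c i - d i.
have e0 : frob_lin s e = 0 by rewrite frob_linD frob_linN cd subrr.
have [|u eu] := local_unit noethR locm (x := e j).
  by move=> /(ideal_subr idm (md j) ) mej; apply: mcj.
(* The entry is dropped by position, not by value, since [s] may contain repetitions. *)
pose s' := [seq s`_i | i <- rem j (iota 0 (size s))].
have s's : {subset s' <= s}.
  by move=> y /mapP[i /mem_rem]; rewrite mem_iota /= => si ->; exact: mem_nth.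
have ss' i : i != j -> (i < size s)%N -> frob_span s' s`_i.
  move=> ij si; have : s`_i \in s'.
    by apply: map_f; rewrite mem_rem_uniq ?iota_uniq// !inE ij mem_iota /=.
  by move=> /(nthP 0)[k ks' <-]; exact: frob_span_nth.
have : (size s <= size s')%N.
  apply: mins; first by move=> y /s's/sg.
  apply/seteqP; split=> // z _.
  have : frob_span s z by rewrite sT.
  apply: frob_span_trans => i si; have [->|] := eqVneq i j; last by move=> /ss'; apply.
  have -> : s`_j = (- u) ^+ p * \sum_(i < size s | i != Ordinal js) e i ^+ p * s`_i.
    move: e0; rewrite /frob_lin (bigD1 (Ordinal js))//= => /eqP.
    rewrite addr_eq0 => /eqP eS.
    by rewrite pchar_exprN mulNr -mulrN -eS mulrA -exprMn [u * _]mulrC eu expr1n mul1r.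
  apply: frob_spanZ; elim/big_rec: _ => [|k y kj ys']; first exact: frob_span0.
  by apply: frob_spanD => //; apply: frob_spanZ; exact: ss'.
rewrite size_map size_rem ?mem_iota//= size_iota.
by move: js; case: (size s) => // n _; rewrite ltnn.
Qed.

(* Kunz's theorem for a regular local ring: descend along a regular system of
   parameters x_1, ..., x_d, dividing relations modulo x_1^p, ..., x_i^p by x_i^p
   and applying Nakayama to the ideals of their coefficients. *)
Lemma minimal_frob_span_free s :
    (forall c, adjoin [set 0] (frob_seq x) (frob_lin s c) ->
      forall j, (j < size s)%N -> m (c j)) ->
  forall c, frob_lin s c = 0 -> forall j, (j < size s)%N -> c j = 0.
Proof.
move=> sm.
(* For [t1] = x the claim follows from [sm], because m is the ideal of x; for the empty [t1] it is
   freeness. *)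
suff h t1 t2 : x = t1 ++ t2 -> forall c, adjoin [set 0] (frob_seq t1) (frob_lin s c) ->
    forall j, (j < size s)%N -> adjoin [set 0] t1 (c j).
  by move=> c c0 j js; apply: (h [::] x) => //; rewrite c0.
elim: t2 t1 => [|y t2 ih] t1 xE c ct j js.
  have xt : x = t1 by rewrite xE cats0.
  by have := sm c; rewrite xt => /(_ ct j js); case: regx => _ -> _; rewrite xt.
pose J := adjoin [set 0] (frob_seq t1).
have idJ : ideal J by apply: adjoin_ideal; exact: ideal_set0.
have idt : ideal (adjoin [set 0] t1) by apply: adjoin_ideal; exact: ideal_set0.
pose C := [set a | exists2 d, J (frob_lin s d) & a = d j].
have idC : ideal C.
  apply: mk_ideal => [|_ _ [d Jd ->] [e Je ->]|a _ [d Jd ->]].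
  - by exists (fun=> 0); rewrite // frob_lin0; exact: ideal0.
  - by exists (fun i => d i + e i); rewrite // frob_linD; exact: idealD.
  - by exists (fun i => a * d i); rewrite // frob_linZ; exact: idealMl.
suff : C `<=` adjoin [set 0] t1 by apply; exists c.
apply: (local_nakayama noethR locm) => // _ [d Jd ->].
(* By induction each coefficient is u + e y with u in the ideal of [t1]. The u-part is a relation
   modulo J, hence so is y^p times the e-part, and y can be cancelled. So C lies in (t1) + y C. *)
have dE i : exists ue, (i < size s)%N -> adjoin [set 0] t1 ue.1 /\ d i = ue.1 + ue.2 * y.
  have [si|//] := ltnP i (size s); last by exists (0, 0).
  have /adjoin1P[u tu [a da]] : adjoin (adjoin [set 0] t1) [:: y] (d i).
    rewrite -adjoin_cat; last exact: ideal_set0.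
    apply: (ih (t1 ++ [:: y])) => //; first by rewrite -catA.
    rewrite map_cat adjoin_cat; last exact: ideal_set0.
    exact: sub_adjoin.
  by exists (u, a).
have [ue {}dE] := choice dE.
have Jue : J (frob_lin s (fun i => (ue i).1)).
  by apply: ideal_sum => // i _; apply: idealMr => //; apply: adjoin_frob; case: (dE i).
have Jye : J (y ^+ p * frob_lin s (fun i => (ue i).2)).
  rewrite (_ : _ * _ = frob_lin s d - frob_lin s (fun i => (ue i).1)); first exact: idealB.
  apply/eqP; rewrite eq_sym subr_eq -frob_linZ addrC -frob_linD.
  apply/eqP; apply: eq_bigr => i _; have [_ ->] := dE i (ltn_ord i).
  by rewrite [y * _]mulrC.
have [ut dj] := dE j js.
exists (ue j).1 => //; rewrite dj addrAC subrr add0r mulrC; apply: mem_ideal_mul.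
  by apply: xm; rewrite xE mem_cat mem_head orbT.
exists (fun i => (ue i).2) => //.
have yJ z : J (y * z) -> J z.
  apply: (@regular_system_nonzerodivisor _ m x p [::] t1 t2 y regx).
  by rewrite xE; apply/permP => a; rewrite /= !count_cat /=; lia.
suff ynJ n z : J (y ^+ n * z) -> J z by exact: ynJ Jye.
by elim: n => [|n ihn]; rewrite ?mul1r// exprS -mulrA => /yJ.
Qed.

Lemma exists_frob_basis g : frob_span g = setT -> exists s,
  [/\ {subset s <= g}, frob_span s = setT &
      forall c, frob_lin s c = 0 -> forall j, (j < size s)%N -> c j = 0].
Proof.
move=> /exists_minimal_frob_span[s [sg sT mins]]; exists s; split=> //.
by apply: minimal_frob_span_free => c; exact: (minimal_frob_span_coef sg sT mins).
Qed.

End FrobeniusSpan.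

(** * Spreading a Frobenius basis at a prime out to a dual basis *)

Section Localization.
Variables (R B : comNzRingType) (S : set R) (f : {rmorphism R -> B}).
Hypotheses (multS : mult_closed S) (locf : is_localization S f).

Lemma mult_closed_prod (T : Type) (r : seq T) (F : T -> R) :
  (forall i, S (F i)) -> S (\prod_(i <- r) F i).
Proof.
move=> SF; elim/big_rec: _ => [|i x _ Sx]; first by case: multS.
by case: multS => _; apply.
Qed.

Lemma common_denominator (T : finType) (F : T -> B) :
  exists v, S v /\ exists u : T -> R, forall i, F i * f v = f (u i).
Proof.
have [_ den _] := locf.
have /choice[xv xvF] : forall i, exists xv, S xv.2 /\ F i * f xv.2 = f xv.1.
  by move=> i; have [x [v [Sv e]]] := den (F i); exists (x, v).
exists (\prod_i (xv i).2); split; first by apply: mult_closed_prod => i; case: (xvF i).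
exists (fun i => (xv i).1 * \prod_(j | j != i) (xv j).2) => i.
by rewrite (bigD1 i)//= !rmorphM mulrA (xvF i).2.
Qed.

Lemma common_annihilator (T : finType) (F : T -> R) :
  (forall i, f (F i) = 0) -> exists w, S w /\ forall i, w * F i = 0.
Proof.
have [_ _ ker] := locf; move=> F0.
have /choice[w wF] : forall i, exists w, S w /\ w * F i = 0 by move=> i; exact: ker.
exists (\prod_i w i); split; first by apply: mult_closed_prod => i; case: (wF i).
by move=> i; rewrite (bigD1 i)//= mulrAC (wF i).2 mul0r.
Qed.

Lemma common_annihilator_ideal (I : set R) : noetherian R -> ideal I ->
  (forall x, I x -> f x = 0) -> exists w, S w /\ forall x, I x -> w * x = 0.
Proof.
move=> noethR idI I0; have [s Is] := noetherian_adjoin noethR idI.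
have [i|w [Sw ws]] := @common_annihilator 'I_(size s) (fun i => s`_i).
  by apply: I0; rewrite Is; apply: mem_adjoin; [exact: ideal_set0|exact: mem_nth].
exists w; split=> // x; rewrite Is.
have : adjoin [set 0] s `<=` [set x | [set (0 : R)] (w * x)].
  apply: adjoin_sub; first exact: (ideal_preim _ ideal_set0).
    by move=> _ ->; rewrite /= mulr0.
  by move=> y /(nthP 0)[i si <-] /=; exact: (ws (Ordinal si)).
exact.
Qed.

End Localization.

Section DualBasis.
Variables (R : comNzRingType) (p : nat).
Hypothesis charp : p \in [pchar R].

Definition cartier_map (th : R -> R) :=
  (forall x y, th (x + y) = th x + th y) /\ (forall a x, th (a ^+ p * x) = a * th x).

Lemma cartier_map0 th : cartier_map th -> th 0 = 0.
Proof. by case=> thD _; apply: (addrI (th 0)); rewrite -thD !addr0. Qed.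

Lemma cartier_map_scale a th : cartier_map th -> cartier_map (fun x => a * th x).
Proof. by case=> thD thM; split=> [x y|b x]; rewrite ?thD ?thM ?mulrDr// mulrCA. Qed.

Definition frob_dual_basis (r : R) : Prop :=
  exists (I : finType) (th : I -> R -> R) (L : I -> R),
    (forall i, cartier_map (th i)) /\
    forall x, r ^+ p * x = \sum_i th i x ^+ p * L i.

Lemma frob_dual_basis_ideal : ideal frob_dual_basis.
Proof.
apply: mk_ideal => [|r1 r2 [I1 [th1 [L1 [c1 h1]]]] [I2 [th2 [L2 [c2 h2]]]]|a r [I [th [L [c h]]]]].
- exists void, (fun _ x => x), (fun=> 0); split; first by case.
  by move=> x; rewrite pchar_expr0// mul0r big1// => -[].
- exists (I1 + I2)%type, (fun i => match i with inl i => th1 i | inr i => th2 i end),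
    (fun i => match i with inl i => L1 i | inr i => L2 i end); split; first by case.
  by move=> x; rewrite pchar_exprD// mulrDl h1 h2 big_sumType.
- exists I, (fun i x => a * th i x), L; split; first by move=> i; exact: cartier_map_scale.
  move=> x; rewrite exprMn -mulrA h mulr_sumr; apply: eq_bigr => i _.
  by rewrite exprMn mulrA.
Qed.

Section AtPrime.
Hypothesis noethR : noetherian R.
Variables (M : nat) (s : 'I_M -> R).
Hypothesis spans : forall x, exists c : 'I_M -> R, x = \sum_(i < M) c i ^+ p * s i.
Variables (S : set R) (B : comNzRingType) (f : {rmorphism R -> B}).
Hypotheses (multS : mult_closed S) (locf : is_localization S f).

Lemma localization_pchar : p \in [pchar B].
Proof.
by rewrite inE (pcharf_prime charp)/= -(rmorph_nat f) (pcharf0 charp) rmorph0.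
Qed.
Let charB := localization_pchar.

Lemma localization_frob_span : frob_span p [seq f (s i) | i <- enum 'I_M] = setT.
Proof.
apply/seteqP; split=> // b _.
have [unit den _] := locf; have [x [u [Su bu]]] := den b.
have [y uy] := unit u Su.
(* Writing x / u as u^-p times x u^(p-1) makes the denominator a p-th power, which is an admissible
   scalar. *)
have [c xc] := spans (x * u ^+ p.-1).
have pE : p = p.-1.+1 by have := prime_gt0 (pcharf_prime charp); case: (p).
have -> : b = y ^+ p * \sum_(i < M) f (c i) ^+ p * f (s i).
  rewrite [RHS](_ : _ = y ^+ p * f (x * u ^+ p.-1)); last first.
    by rewrite xc rmorph_sum; congr (_ * _); apply: eq_bigr => i _; rewrite rmorphM rmorphXn.
  rewrite rmorphM -bu rmorphXn -mulrA -exprS -pE mulrCA -exprMn [y * _]mulrC uy.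
  by rewrite expr1n mulr1.
apply: frob_spanZ; elim/big_rec: _ => [|i z _ zs]; first exact: frob_span0.
apply: frob_spanD => //; apply: frob_spanZ.
have : f (s i) \in [seq f (s i) | i <- enum 'I_M] by apply: map_f; rewrite mem_enum.
by move=> /(nthP 0)[k ks <-]; exact: frob_span_nth.
Qed.

Variable t : seq B.
Hypotheses (tT : frob_span p t = setT) (ts : {subset t <= [seq f (s i) | i <- enum 'I_M]}).
Hypothesis t_free : forall c, frob_lin p t c = 0 -> forall j, (j < size t)%N -> c j = 0.

(** The coordinates with respect to [t] descend to R after multiplication by three elements of S: v
    clears their denominators on the generators, [w0] makes the lifts well defined, and [w'] turns
    the identity in B into one in R. *)
Lemma frob_dual_basis_local : exists2 r, S r & frob_dual_basis r.
Proof.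
have /choice[psi psiE] : forall b, exists c, b = frob_lin p t c.
  by move=> b; have : frob_span p t b by rewrite tT.
have psi_uniq c d : frob_lin p t c = frob_lin p t d ->
    forall j, (j < size t)%N -> c j = d j.
  move=> e j jt; apply/eqP; rewrite -subr_eq0; apply/eqP.
  by apply: (t_free (c := fun j => c j - d j)) => //; rewrite frob_linD// frob_linN// e subrr.
pose I := 'I_(size t).
have /choice[L LE] : forall j : I, exists l, t`_j = f l.
  by move=> j; have /ts/mapP[i _ ->] := mem_nth 0 (ltn_ord j); exists (s i).
have [v [Sv [u0 uE]]] := common_denominator multS locf
  (fun ij : 'I_M * I => psi (f (s ij.1)) ij.2).
pose u i j := u0 (i, j).
have {}uE i j : f (u i j) = psi (f (s i)) j * f v by rewrite -uE.
have psi_lin (c : 'I_M -> R) (j : I) :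
    f (\sum_i c i * u i j) = psi (f (\sum_i c i ^+ p * s i)) j * f v.
  have <- : \sum_i f (c i) * psi (f (s i)) j = psi (f (\sum_i c i ^+ p * s i)) j.
    apply: (psi_uniq (fun j => \sum_i f (c i) * psi (f (s i)) j)) => //.
    rewrite -psiE rmorph_sum.
    rewrite frob_lin_sum//; apply: eq_bigr => i _.
    by rewrite -psiE rmorphM rmorphXn.
  rewrite rmorph_sum mulr_suml; apply: eq_bigr => i _.
  by rewrite rmorphM uE mulrA.
(* A lifted coordinate of x depends on how x is written in the generators. [N j] collects the
   ambiguity; it is an ideal vanishing in B, so one element of S kills it. *)
pose N (j : I) := [set z | exists2 c : 'I_M -> R,
  \sum_i c i ^+ p * s i = 0 & z = \sum_i c i * u i j].
have idN j : ideal (N j).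
  apply: mk_ideal => [|_ _ [c c0 ->] [d d0 ->]|a _ [c c0 ->]].
  - by exists (fun=> 0); rewrite big1// => i _; rewrite ?pchar_expr0// mul0r.
  - exists (fun i => c i + d i); last by rewrite -big_split /=; apply: eq_bigr => i _; rewrite mulrDl.
    rewrite (eq_bigr (fun i => c i ^+ p * s i + d i ^+ p * s i)) => [|i _].
      by rewrite big_split /= c0 d0 addr0.
    by rewrite pchar_exprD// mulrDl.
  - exists (fun i => a * c i); last by rewrite mulr_sumr; apply: eq_bigr => i _; rewrite mulrA.
    rewrite (eq_bigr (fun i => a ^+ p * (c i ^+ p * s i))) => [|i _].
      by rewrite -mulr_sumr c0 mulr0.
    by rewrite exprMn mulrA.
have N0 j z : N j z -> f z = 0.
  move=> [c c0 ->]; rewrite psi_lin c0 rmorph0.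
  rewrite (psi_uniq (psi 0) (fun=> 0)) ?mul0r// -psiE.
  by rewrite frob_lin0.
have /choice[w wN] : forall j, exists w, S w /\ forall x, N j x -> w * x = 0.
  by move=> j; apply: (common_annihilator_ideal multS locf noethR (idN j)); exact: N0.
pose w0 := \prod_j w j.
have Sw0 : S w0 by apply: mult_closed_prod => // j; case: (wN j).
have w0N j x : N j x -> w0 * x = 0.
  by move=> Nx; rewrite /w0 (bigD1 j)//= mulrAC (wN j).2 ?mul0r.
have [co coE] := choice spans.
pose th (j : I) x := w0 * \sum_i co x i * u i j.
have thE j x c : x = \sum_i c i ^+ p * s i -> th j x = w0 * \sum_i c i * u i j.
  move=> xc; apply/eqP; rewrite -subr_eq0 -mulrBr; apply/eqP; apply: (w0N j).
  exists (fun i => co x i - c i).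
    rewrite (eq_bigr (fun i => co x i ^+ p * s i - c i ^+ p * s i)) => [|i _].
      by rewrite sumrB -coE -xc subrr.
    by rewrite pchar_exprD// pchar_exprN// mulrBl.
  by rewrite -sumrB /=; apply: eq_bigr => i _; rewrite mulrBl.
have cth j : cartier_map (th j).
  split=> [x y|a x].
    rewrite (thE j (x + y) (fun i => co x i + co y i)).
      by rewrite -mulrDr -big_split /=; congr (_ * _); apply: eq_bigr => i _; rewrite mulrDl.
    rewrite {1}(coE x) {1}(coE y) -big_split /=; apply: eq_bigr => i _.
    by rewrite pchar_exprD// mulrDl.
  rewrite (thE j (a ^+ p * x) (fun i => a * co x i)).
    by rewrite [RHS]mulrCA [in RHS]mulr_sumr; congr (_ * _); apply: eq_bigr => i _; rewrite mulrA.
  rewrite {1}(coE x) mulr_sumr; apply: eq_bigr => i _.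
  by rewrite exprMn mulrA.
have fth j x : f (th j x) = f (w0 * v) * psi (f x) j.
  rewrite /th rmorphM psi_lin -coE rmorphM; ring.
(* The defect E of the identity is additive and satisfies E(a^p x) = a^p E(x), so it is enough to
   kill it on the generators [s i]. *)
pose E x := \sum_j th j x ^+ p * L j - (w0 * v) ^+ p * x.
have E0 x : f (E x) = 0.
  rewrite /E rmorphB rmorph_sum rmorphM rmorphXn; apply/eqP; rewrite subr_eq0; apply/eqP.
  rewrite [in RHS](psiE (f x)) mulr_sumr; apply: eq_bigr => j _.
  by rewrite rmorphM rmorphXn fth exprMn -mulrA LE.
have [w' [Sw' w'E]] := common_annihilator multS locf (fun i => E0 (s i)).
exists (w' * (w0 * v)); first by apply: multS.2 => //; exact: multS.2.
exists I, (fun j x => w' * th j x), L; split; first by move=> j; exact: cartier_map_scale.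
have ED x y : E (x + y) = E x + E y.
  rewrite /E mulrDr addrACA -opprD -big_split /=; congr (_ - _); apply: eq_bigr => j _.
  by rewrite (cth j).1 pchar_exprD// mulrDl.
have EM a x : E (a ^+ p * x) = a ^+ p * E x.
  rewrite /E mulrBr mulrCA [in RHS]mulr_sumr; congr (_ - _); apply: eq_bigr => j _.
  by rewrite (cth j).2 exprMn mulrA.
have w'E0 x : w' * E x = 0.
  rewrite (coE x); elim/big_rec: _ => [|i y _ wy]; last first.
    by rewrite ED mulrDr wy EM mulrCA w'E mulr0 addr0.
  have -> : E 0 = 0 by apply: (addrI (E 0)); rewrite -ED !addr0.
  by rewrite mulr0.
move=> x; have pE : p = p.-1.+1 by have := prime_gt0 (pcharf_prime charp); case: (p).
have : w' ^+ p * E x = 0 by rewrite pE exprSr -mulrA w'E0 mulr0.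
rewrite /E mulrBr mulr_sumr => /eqP; rewrite subr_eq0 => /eqP e.
by rewrite exprMn -mulrA -e; apply: eq_bigr => j _; rewrite mulrA -exprMn.
Qed.

End AtPrime.

(* Kunz's theorem: a dual basis says that R is projective over itself via Frobenius.
   The r for which r times the identity factors through a free module form an ideal;
   by the local case it lies in no maximal ideal. *)
Lemma regular_frob_dual_basis : regular R -> F_finite R p -> frob_dual_basis 1.
Proof.
move=> [noethR regR] [M [s spans]]; apply: contrapT => nT1.
have [m maxm Tm] := exists_maximal noethR frob_dual_basis_ideal nT1.
have pm := maximal_prime maxm.
have [B [f [locf [noethB [mB [d [locB dimB [x xE]]]]]]]] := regR m pm.
have multm : mult_closed (~` m).
  by split=> [|y z]; [case: pm|exact: prime_idealM].
have regx := regular_systemP noethB locB dimB xE.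
have charB := localization_pchar f.
have [t [tg tT tfree]] := exists_frob_basis charB noethB regx
  (localization_frob_span spans locf).
have [r mr Tr] := frob_dual_basis_local noethR spans multm locf tT tg tfree.
by apply: mr; exact: Tm.
Qed.

End DualBasis.

(** * Frobenius powers and Cartier roots *)

Section IdealArithmetic.
Variable R : comNzRingType.
Implicit Types (I J K U V : set R) (x y : R) (s t : seq R).

Lemma ideal_mulS I I' J J' : I `<=` I' -> J `<=` J' -> ideal_mul I J `<=` ideal_mul I' J'.
Proof.
move=> II' JJ'; apply: ideal_mul_sub; first exact: ideal_mul_ideal.
by move=> x y /II' Ix /JJ'; exact: mem_ideal_mul.
Qed.

Lemma ideal_mulC I J : ideal_mul I J = ideal_mul J I.
Proof.
by apply/seteqP; split; apply: ideal_mul_sub; try exact: ideal_mul_ideal;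
  move=> x y Ix Jy; rewrite mulrC; apply: mem_ideal_mul.
Qed.

Lemma ideal_mulA I J K : ideal_mul I (ideal_mul J K) = ideal_mul (ideal_mul I J) K.
Proof.
apply/seteqP; split; apply: ideal_mul_sub; try exact: ideal_mul_ideal.
- move=> x w Ix.
  have : ideal_mul J K `<=` [set w | ideal_mul (ideal_mul I J) K (x * w)].
    apply: ideal_mul_sub; first by apply: ideal_preim; exact: ideal_mul_ideal.
    by move=> y z Jy Kz /=; rewrite mulrA; do 2?apply: mem_ideal_mul.
  exact.
- move=> w z + Kz.
  have : ideal_mul I J `<=` [set w | ideal_mul I (ideal_mul J K) (w * z)].
    apply: ideal_mul_sub; first by apply: ideal_colon; exact: ideal_mul_ideal.
    by move=> x y Ix Jy /=; rewrite -mulrA; do 2?apply: mem_ideal_mul.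
  exact.
Qed.

Lemma ideal_mulACA I J K U :
  ideal_mul (ideal_mul I J) (ideal_mul K U) = ideal_mul (ideal_mul I K) (ideal_mul J U).
Proof. by rewrite -!ideal_mulA; congr ideal_mul; rewrite !ideal_mulA [ideal_mul J K]ideal_mulC. Qed.

Lemma ideal_mulT I : ideal I -> ideal_mul I setT = I.
Proof.
move=> idI; apply/seteqP; split=> [|x Ix].
  by apply: ideal_mul_sub => // x y Ix _; exact: idealMr.
by rewrite -[x]mulr1; apply: mem_ideal_mul.
Qed.

Lemma ideal_exp_add I m n : ideal I ->
  ideal_mul (ideal_exp I m) (ideal_exp I n) = ideal_exp I (m + n).
Proof.
move=> idI; elim: m => [|m ih].
  by rewrite ideal_mulC ideal_mulT//; exact: ideal_exp_ideal.
by rewrite /= -ideal_mulA ih.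
Qed.

Lemma ideal_exp_anti I m n : ideal I -> (m <= n)%N -> ideal_exp I n `<=` ideal_exp I m.
Proof.
move=> idI /subnK <-; rewrite addnC -ideal_exp_add//.
apply: ideal_mul_sub; first exact: ideal_exp_ideal.
by move=> x y Ix _; apply: idealMr => //; exact: ideal_exp_ideal.
Qed.

Lemma mem_ideal_exp_mul I m n x : ideal I -> ideal_exp I m x -> ideal_exp I (m * n) (x ^+ n).
Proof.
move=> idI Ix; elim: n => [|n ih]; first by rewrite muln0.
by rewrite exprS mulnS -ideal_exp_add//; apply: mem_ideal_mul.
Qed.

Lemma frob_power_ideal J q : ideal (frob_power J q).
Proof. exact: ideal_gen_ideal. Qed.

Lemma mem_frob_power J q x : J x -> frob_power J q (x ^+ q).
Proof. by move=> Jx; apply: sub_ideal_gen; exists x. Qed.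

Lemma frob_power_sub J q K : ideal K -> (forall x, J x -> K (x ^+ q)) -> frob_power J q `<=` K.
Proof. by move=> idK h; apply: ideal_gen_sub => // _ [x Jx ->]; exact: h. Qed.

Lemma frob_powerT q : frob_power (@setT R) q = setT.
Proof.
by apply: ideal1; [exact: frob_power_ideal|rewrite -(expr1n R q); exact: mem_frob_power].
Qed.

Lemma frob_power1 J : ideal J -> frob_power J 1 = J.
Proof.
move=> idJ; apply/seteqP; split; first exact: frob_power_sub.
by move=> x Jx; rewrite -[x]expr1; exact: mem_frob_power.
Qed.

Lemma frob_power_le J q : ideal J -> (0 < q)%N -> frob_power J q `<=` J.
Proof.
move=> idJ q0; apply: frob_power_sub => // x Jx.
by case: q q0 => // q _; rewrite exprS; exact: idealMr.
Qed.

Lemma frob_power_exp I m q : ideal I -> frob_power (ideal_exp I m) q `<=` ideal_exp I (m * q).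
Proof.
move=> idI; apply: frob_power_sub; first exact: ideal_exp_ideal.
by move=> x; exact: mem_ideal_exp_mul.
Qed.

Lemma frob_power_mul_sub I J q :
  ideal_mul (frob_power I q) (frob_power J q) `<=` frob_power (ideal_mul I J) q.
Proof.
have idF := frob_power_ideal (ideal_mul I J) q.
apply: ideal_mul_sub => // u v.
have : frob_power I q `<=` [set u | forall v, frob_power J q v ->
    frob_power (ideal_mul I J) q (u * v)].
  apply: frob_power_sub.
    apply: mk_ideal => [w _|x y Ix Iy w Jw|a x Ix w Jw].
    - by rewrite mul0r; exact: (ideal0 idF).
    - by rewrite mulrDl; apply: (idealD idF); [exact: Ix|exact: Iy].
    - by rewrite -mulrA; apply: (idealMl _ idF); exact: Ix.
  move=> x Ix {}v; have : frob_power J q `<=` [set v | frob_power (ideal_mul I J) q (x ^+ q * v)].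
    apply: frob_power_sub; first exact: ideal_preim.
    by move=> y Jy /=; rewrite -exprMn; apply: mem_frob_power; exact: mem_ideal_mul.
  exact.
by move=> h Iu; exact: h.
Qed.

Lemma ideal_exp_adjoin_cons y t N : ideal_exp (adjoin [set 0] (y :: t)) N `<=`
  ideal_gen [set w | exists i z,
    [/\ (i <= N)%N, ideal_exp (adjoin [set 0] t) (N - i) z & w = y ^+ i * z]].
Proof.
elim: N => [|N ih].
  by move=> w _; apply: sub_ideal_gen; exists 0%N, w; split=> //; rewrite mul1r.
apply: ideal_mul_sub; first exact: ideal_gen_ideal.
move=> x w [b [r [_ tr ->]]] /ih.
set S := [set _ | _]; set S' := [set _ | _]; have idS' := ideal_gen_ideal S'.
have : ideal_gen S `<=` [set w | ideal_gen S' ((b * y + r) * w)].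
  apply: ideal_gen_sub; first exact: ideal_preim.
  move=> _ [i [z [iN tz ->]]] /=; rewrite mulrDl.
  apply: (idealD idS').
    rewrite -mulrA; apply: (idealMl _ idS').
    by apply: sub_ideal_gen; exists i.+1, z; rewrite exprS mulrA subSS.
  rewrite mulrCA; apply: sub_ideal_gen; exists i, (r * z); split=> //; first exact: leqW.
  by rewrite subSn//; exact: mem_ideal_mul.
exact.
Qed.

(* Among N > r q factors taken from r generators, some generator occurs q times. *)
Lemma ideal_exp_pigeonhole q s t N : {subset t <= s} -> (size t * q < N)%N ->
  let A := adjoin [set 0] s in
  ideal_exp (adjoin [set 0] t) N `<=` ideal_mul (frob_power A q) (ideal_exp A (N - q)).
Proof.
move=> + + A; have idA : ideal A by apply: adjoin_ideal; exact: ideal_set0.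
elim: t N => [|y t ih] N ts tN.
  case: N tN => // N _; apply: ideal_mul_sub; first exact: ideal_mul_ideal.
  by move=> x z -> _; rewrite mul0r; apply: ideal0; exact: ideal_mul_ideal.
have ts' : {subset t <= s} by move=> z zt; apply: ts; rewrite inE zt orbT.
have Ay : A y by apply: mem_adjoin; [exact: ideal_set0|apply: ts; rewrite mem_head].
have tA : adjoin [set 0] t `<=` A by apply: adjoin_subset => //; exact: ideal_set0.
have tAn n : ideal_exp (adjoin [set 0] t) n `<=` ideal_exp A n.
  by elim: n => //= n ihn; exact: ideal_mulS.
move=> w /ideal_exp_adjoin_cons; move: w; apply: ideal_gen_sub; first exact: ideal_mul_ideal.
move=> _ [i [z [iN tz ->]]]; have [qi|iq] := leqP q i.
  rewrite -(subnKC qi) exprD -mulrA; apply: mem_ideal_mul; first exact: mem_frob_power.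
  rewrite (_ : N - q = (i - q) + (N - i))%N; last by lia.
  rewrite -ideal_exp_add//; apply: mem_ideal_mul; last exact: tAn.
  exact: mem_ideal_exp.
(* Only an inequality: the subtraction truncates when fewer than q factors are left, which can
   happen for empty [t]. *)
have leN : (N - q <= i + (N - i - q))%N by lia.
apply: (ideal_mulS (@subset_refl _ _) (ideal_exp_anti idA leN)).
rewrite -ideal_exp_add// ideal_mulA [ideal_mul (frob_power _ _) _]ideal_mulC -ideal_mulA.
apply: mem_ideal_mul; first exact: mem_ideal_exp.
by apply: ih => //; move: tN; rewrite /= mulSn; lia.
Qed.

(** As long as there are more than [size s * q] factors, the pigeonhole splits off a Frobenius power
    of A; this is repeated u times. The case u = 0 admits exponents below the threshold, where
    nothing is split off. *)
Lemma ideal_exp_skoda s q m u : (0 < q)%N -> (u = 0%N \/ (size s * q <= m)%N) ->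
  let A := adjoin [set 0] s in
  ideal_exp A (m + q * u) = ideal_mul (frob_power (ideal_exp A u) q) (ideal_exp A m).
Proof.
move=> q0 + A; have idA : ideal A by apply: adjoin_ideal; exact: ideal_set0.
case=> [->|sm].
  by rewrite muln0 addn0 /= frob_powerT ideal_mulC ideal_mulT//; exact: ideal_exp_ideal.
apply/seteqP; split.
  elim: u => [|u ih].
    by rewrite muln0 addn0 /= frob_powerT ideal_mulC ideal_mulT//; exact: ideal_exp_ideal.
  have h : ideal_exp A (m + q * u.+1) `<=`
      ideal_mul (frob_power A q) (ideal_exp A (m + q * u)).
    rewrite (_ : m + q * u = m + q * u.+1 - q)%N; last by rewrite mulnS; lia.
    by apply: ideal_exp_pigeonhole => //; rewrite mulnS; lia.
  move=> x /h; move: x; apply: subset_trans (ideal_mulS (@subset_refl _ _) ih) _.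
  by rewrite ideal_mulA; apply: ideal_mulS => //; exact: frob_power_mul_sub.
rewrite addnC [(q * u)%N]mulnC -ideal_exp_add//; apply: ideal_mulS => //.
exact: frob_power_exp.
Qed.

Section PrimeCharacteristic.
Variable p : nat.
Hypothesis charp : p \in [pchar R].

Lemma pchar_exprD_pow e x y : (x + y) ^+ (p ^ e) = x ^+ (p ^ e) + y ^+ (p ^ e).
Proof.
elim: e x y => [|e ih] x y; first by rewrite !expr1.
by rewrite expnSr !exprM ih pchar_exprD.
Qed.

Lemma ideal_frob_preim I e : ideal I -> ideal [set x | I (x ^+ (p ^ e))].
Proof.
have pe0 : (0 < p ^ e)%N by rewrite expn_gt0 prime_gt0// (pcharf_prime charp).
move=> idI; apply: mk_ideal => /= [|x y Ix Iy|a x Ix].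
- by rewrite expr0n -[(_ == 0)%N]negbK -lt0n pe0; exact: ideal0.
- by rewrite pchar_exprD_pow; exact: idealD.
- by rewrite exprMn; exact: idealMl.
Qed.

Lemma frob_power_mul I J e : frob_power (ideal_mul I J) (p ^ e) =
  ideal_mul (frob_power I (p ^ e)) (frob_power J (p ^ e)).
Proof.
apply/seteqP; split; last exact: frob_power_mul_sub.
have idm := ideal_mul_ideal (frob_power I (p ^ e)) (frob_power J (p ^ e)).
apply: frob_power_sub => //.
apply: (ideal_mul_sub (ideal_frob_preim e idm)) => x y Ix Jy /=.
by rewrite exprMn; apply: mem_ideal_mul; exact: mem_frob_power.
Qed.

Lemma frob_power_pow J e : frob_power J (p ^ e.+1) = frob_power (frob_power J (p ^ e)) p.
Proof.
apply/seteqP; split; apply: frob_power_sub; try exact: frob_power_ideal.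
  by move=> x Jx; rewrite expnSr exprM; do 2?apply: mem_frob_power.
have idF : ideal [set x | frob_power J (p ^ e.+1) (x ^+ (p ^ 1))].
  by apply: ideal_frob_preim; exact: frob_power_ideal.
apply: (@ideal_gen_sub _ _ [set x | frob_power J (p ^ e.+1) (x ^+ p)]).
  by move: idF; rewrite expn1.
by move=> _ [x Jx ->] /=; rewrite -exprM -expnSr; exact: mem_frob_power.
Qed.

(** * The Frobenius root as the ideal of values of a dual basis *)

Section CartierRoot.
Variables (T : finType) (th : T -> R -> R) (L : T -> R).
Hypotheses (cth : forall i, cartier_map p (th i))
  (thL : forall x, x = \sum_i th i x ^+ p * L i).

Definition cartier_root (b : set R) : set R :=
  ideal_gen [set z | exists i x, b x /\ z = th i x].

Lemma cartier_root_ideal b : ideal (cartier_root b).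
Proof. exact: ideal_gen_ideal. Qed.

Lemma mem_cartier_root (b : set R) i x : b x -> cartier_root b (th i x).
Proof. by move=> bx; apply: sub_ideal_gen; exists i, x. Qed.

Lemma iter_cartier_root_ideal b e : ideal b -> ideal (iter e cartier_root b).
Proof. by case: e => // e _; exact: cartier_root_ideal. Qed.

Lemma cartier_rootS b b' : b `<=` b' -> cartier_root b `<=` cartier_root b'.
Proof.
move=> bb'; apply: ideal_gen_mono => z [i [x [bx ->]]].
by exists i, x; split=> //; exact: bb'.
Qed.

Lemma iter_cartier_rootS e b b' : b `<=` b' ->
  iter e cartier_root b `<=` iter e cartier_root b'.
Proof. by move=> bb'; elim: e => //= e; exact: cartier_rootS. Qed.

(** Quantifying over a makes this set closed under multiplication, which [th i] alone does not
    respect. *)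
Lemma ideal_cartier_preim J i : ideal J -> ideal [set x | forall a, J (th i (a * x))].
Proof.
have [thD thM] := cth i.
move=> idJ; apply: mk_ideal => /= [a|x y Jx Jy a|b x Jx a].
- by rewrite mulr0 (cartier_map0 (cth i)); exact: ideal0.
- by rewrite mulrDr thD; exact: idealD.
- by rewrite mulrA; exact: Jx.
Qed.

(** This adjunction identifies C(b) with the Frobenius root: the dual basis identity gives one
    direction, p^-1-linearity the other. *)
Lemma cartier_root_sub b J : ideal J -> cartier_root b `<=` J <-> b `<=` frob_power J p.
Proof.
move=> idJ; split=> [bJ x bx|bJ].
  have idF := frob_power_ideal J p.
  rewrite [x]thL; apply: (ideal_sum _ idF) => i _; apply: (idealMr _ idF).
  by apply: mem_frob_power; apply: bJ; exact: mem_cartier_root.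
apply: ideal_gen_sub => // _ [i [x [/bJ Jx ->]]].
have : frob_power J p `<=` [set x | forall a, J (th i (a * x))].
  apply: frob_power_sub; first exact: ideal_cartier_preim.
  by move=> y Jy a /=; rewrite mulrC (cth i).2; exact: idealMr.
by move=> /(_ x Jx 1); rewrite mul1r.
Qed.

Lemma iter_cartier_root_sub e b J : ideal J ->
  iter e cartier_root b `<=` J <-> b `<=` frob_power J (p ^ e).
Proof.
move=> idJ; elim: e b => [|e ih] b; first by rewrite /= frob_power1.
rewrite iterSr ih frob_power_pow; apply: cartier_root_sub.
exact: frob_power_ideal.
Qed.

Lemma frob_root_iter e b : ideal b -> frob_root b (p ^ e) = iter e cartier_root b.
Proof.
move=> idb; have idC := iter_cartier_root_ideal e idb.
apply/seteqP; split=> [x|x Cx J [idJ /(iter_cartier_root_sub _ _ idJ)]]; last exact.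
apply; split=> //; exact/iter_cartier_root_sub.
Qed.

Lemma cartier_root_mul J b : ideal b ->
  cartier_root (ideal_mul (frob_power J p) b) = ideal_mul J (cartier_root b).
Proof.
move=> idb; apply/seteqP; split.
  apply: ideal_gen_sub; first exact: ideal_mul_ideal.
  move=> _ [i [x [+ ->]]].
  have idJ := ideal_mul_ideal J (cartier_root b).
  have idP := ideal_cartier_preim i idJ.
  have : ideal_mul (frob_power J p) b `<=`
      [set x | forall a, ideal_mul J (cartier_root b) (th i (a * x))].
    apply: ideal_mul_sub => // u v + bv.
    have : frob_power J p `<=`
        [set u | forall a, ideal_mul J (cartier_root b) (th i (a * (u * v)))].
      apply: frob_power_sub.
        by have := ideal_colon v idP; apply.
      move=> y Jy a /=; rewrite mulrCA (cth i).2; apply: mem_ideal_mul => //.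
      by apply: mem_cartier_root; exact: idealMl.
    exact.
  by move=> h /h/(_ 1); rewrite mul1r.
apply: ideal_mul_sub; first exact: cartier_root_ideal.
move=> y z Jy.
have : cartier_root b `<=` [set z | cartier_root (ideal_mul (frob_power J p) b) (y * z)].
  apply: ideal_gen_sub; first by apply: ideal_preim; exact: cartier_root_ideal.
  move=> _ [i [x [bx ->]]] /=; rewrite -(cth i).2; apply: mem_cartier_root.
  by apply: mem_ideal_mul => //; exact: mem_frob_power.
exact.
Qed.

Lemma iter_cartier_root_mul e J b : ideal b ->
  iter e cartier_root (ideal_mul (frob_power J (p ^ e)) b) =
  ideal_mul J (iter e cartier_root b).
Proof.
elim: e J b => [|e ih] J b idb.
  rewrite /=; apply/seteqP; split; apply: ideal_mul_sub; try exact: ideal_mul_ideal.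
    move=> x y + by_; have : frob_power J 1 `<=` [set x | ideal_mul J b (x * y)].
      apply: frob_power_sub; first by apply: ideal_colon; exact: ideal_mul_ideal.
      by move=> u Ju /=; rewrite expr1; exact: mem_ideal_mul.
    exact.
  move=> x y Jx by_; apply: mem_ideal_mul => //.
  by rewrite -[x]expr1; exact: mem_frob_power.
rewrite !iterSr frob_power_pow cartier_root_mul// ih//.
exact: cartier_root_ideal.
Qed.

Lemma cartier_rootT : cartier_root setT = setT.
Proof.
have idC := cartier_root_ideal setT.
apply: ideal1 => //.
apply: (frob_power_le (q := p)) => //; first by rewrite prime_gt0// (pcharf_prime charp).
by have /(cartier_root_sub _ idC) := @subset_refl _ (cartier_root setT); apply.
Qed.

Lemma sub_cartier_root_frob_power J b : ideal J -> frob_power J p `<=` b ->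
  J `<=` cartier_root b.
Proof.
move=> idJ Jb; apply: subset_trans (cartier_rootS Jb).
rewrite -[frob_power J p]ideal_mulT ?cartier_root_mul//; last exact: frob_power_ideal.
by rewrite cartier_rootT ideal_mulT.
Qed.

End CartierRoot.
End PrimeCharacteristic.
End IdealArithmetic.

(** * Ideals generated in bounded degree *)

Section Submodules.
Variables (A : pzRingType) (M : lmodType A).
Implicit Types (W S : set M).

Lemma mk_submodule W : W 0 -> (forall u v, W u -> W v -> W (u + v)) ->
  (forall (a : A) u, W u -> W (a *: u)) -> submodule W.
Proof. by move=> W0 WD WZ; split=> // a u v Wu Wv; apply: WD => //; exact: WZ. Qed.

Lemma submodule0 W : submodule W -> W 0. Proof. by case. Qed.

Lemma submoduleZ W (a : A) u : submodule W -> W u -> W (a *: u).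
Proof. by case=> W0 h Wu; rewrite -[_ *: _]addr0; exact: h. Qed.

Lemma submoduleD W u v : submodule W -> W u -> W v -> W (u + v).
Proof. by case=> _ h Wu Wv; rewrite -[u]scale1r; exact: h. Qed.

Lemma span_submodule S : submodule (Defs.span S).
Proof.
split=> [W [subW _]|a u v Su Sv W SW]; first exact: submodule0.
by have [subW _] := SW; apply: subW.2; [exact: Su|exact: Sv].
Qed.

Lemma sub_span S : S `<=` Defs.span S.
Proof. by move=> x Sx W [_]; apply. Qed.

Lemma span_sub S W : submodule W -> S `<=` W -> Defs.span S `<=` W.
Proof. by move=> subW SW x; apply. Qed.

End Submodules.

Lemma finite_setT_fin (T : finType) : finite_set [set: T].
Proof.
by apply/finite_seqP; exists (enum T); apply/seteqP; split=> // x _ /=; rewrite mem_enum.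
Qed.

Lemma finite_span (k : finPzRingType) (M : lmodType k) (S : set M) :
  finite_set S -> finite_set (Defs.span S).
Proof.
move=> /finite_seqP[s ->].
suff [W [finW subW sW]] : exists W : set M,
    [/\ finite_set W, submodule W & forall x, x \in s -> W x].
  by apply: sub_finite_set finW; exact: span_sub.
elim: s => [|x s [W [finW subW sW]]].
  exists [set 0]; split=> //.
  by apply: mk_submodule => // [_ _ -> ->|a _ ->]; rewrite /= ?addr0 ?scaler0.
exists [set a *: x + v | a in [set: k] & v in W]; split.
- by apply: finite_image2 => //; exact: finite_setT_fin.
- apply: mk_submodule => [|_ _ [a _ [u Wu <-]] [b _ [v Wv <-]]|b _ [a _ [u Wu <-]]].
  + by exists 0 => //; exists 0; [exact: submodule0|rewrite scale0r addr0].
  + by exists (a + b) => //; exists (u + v); [exact: submoduleD|rewrite scalerDl addrACA].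
  + by exists (b * a) => //; exists (b *: u); [exact: submoduleZ|rewrite scalerDr scalerA].
- move=> y; rewrite inE => /predU1P[->|/sW Wy].
    by exists 1 => //; exists 0; [exact: submodule0|rewrite scale1r addr0].
  by exists 0 => //; exists y => //; rewrite scale0r add0r.
Qed.

Section DegreeFiltration.
Variables (k : finFieldType) (R : comAlgType k) (N : nat) (y : 'I_N -> R).
Implicit Types (al : 'I_N -> nat) (b I J : set R).

Definition monom al : R := \prod_i y i ^+ al i.
Definition mdegree al : nat := (\sum_i al i)%N.
Definition degree_le (D : nat) : set R :=
  Defs.span [set z | exists2 al, (mdegree al <= D)%N & z = monom al].

Lemma monomD al be : monom (fun i => al i + be i)%N = monom al * monom be.
Proof. by rewrite /monom -big_split /=; apply: eq_bigr => i _; rewrite exprD. Qed.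

Lemma monomX al n : monom (fun i => al i * n)%N = monom al ^+ n.
Proof.
by rewrite /monom -prodrXl; apply: eq_bigr => i _; rewrite exprM.
Qed.

Lemma mdegreeD al be : mdegree (fun i => al i + be i)%N = (mdegree al + mdegree be)%N.
Proof. exact: big_split. Qed.

Lemma mdegreeM al n : mdegree (fun i => al i * n)%N = (mdegree al * n)%N.
Proof. by rewrite /mdegree big_distrl. Qed.

Lemma degree_le_submodule D : submodule (degree_le D).
Proof. exact: span_submodule. Qed.

Lemma monom_degree al D : (mdegree al <= D)%N -> degree_le D (monom al).
Proof. by move=> alD; apply: sub_span; exists al. Qed.

Lemma degree_le_sub D (W : set R) : submodule W ->
  (forall al, (mdegree al <= D)%N -> W (monom al)) -> degree_le D `<=` W.
Proof. by move=> subW h; apply: span_sub => // _ [al alD ->]; exact: h. Qed.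

Lemma degree_leS D E : (D <= E)%N -> degree_le D `<=` degree_le E.
Proof.
move=> DE; apply: degree_le_sub; first exact: degree_le_submodule.
by move=> al alD; apply: monom_degree; exact: leq_trans DE.
Qed.

Lemma degree_le1 : degree_le 0 1.
Proof.
rewrite (_ : 1 = monom (fun=> 0%N)); last by rewrite /monom big1.
by apply: monom_degree; rewrite /mdegree big1.
Qed.

Lemma degree_leM D E u v : degree_le D u -> degree_le E v -> degree_le (D + E) (u * v).
Proof.
move=> + Ev; have subV := degree_le_submodule (D + E).
have : degree_le D `<=` [set u | degree_le (D + E) (u * v)].
  apply: degree_le_sub.
    apply: mk_submodule => /= [|a c Va Vc|a c Vc].
    - by rewrite mul0r; exact: (submodule0 subV).
    - by rewrite mulrDl; exact: (submoduleD subV).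
    - by rewrite -scalerAl; exact: (submoduleZ _ subV).
  move=> al alD /=; have : degree_le E `<=` [set v | degree_le (D + E) (monom al * v)].
    apply: degree_le_sub.
      apply: mk_submodule => /= [|a c Va Vc|a c Vc].
      - by rewrite mulr0; exact: (submodule0 subV).
      - by rewrite mulrDr; exact: (submoduleD subV).
      - by rewrite -scalerAr; exact: (submoduleZ _ subV).
    move=> be beE /=; rewrite -monomD; apply: monom_degree.
    by rewrite mdegreeD; exact: leq_add.
  exact.
exact.
Qed.

Lemma degree_leX D u n : degree_le D u -> degree_le (D * n) (u ^+ n).
Proof.
move=> Du; elim: n => [|n ih]; first by rewrite muln0; exact: degree_le1.
by rewrite exprS mulnS; exact: degree_leM.
Qed.

Lemma finite_degree_le D : finite_set (degree_le D).
Proof.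
apply: finite_span.
apply: (@sub_finite_set _ _
  ((fun al : {ffun 'I_N -> 'I_D.+1} => monom (fun i => al i)) @` [set: _])).
  move=> _ [al alD ->].
  have ali i : (al i < D.+1)%N.
    by rewrite ltnS (leq_trans _ alD)// /mdegree (bigD1 i)//= leq_addr.
  exists [ffun i => Ordinal (ali i)] => //.
  by rewrite /monom; apply: eq_bigr => i _; rewrite ffunE.
by apply: finite_image; exact: finite_setT_fin.
Qed.

Definition gen_degree_le (D : nat) b : Prop := b = ideal_gen (b `&` degree_le D).

Lemma mk_gen_degree_le D b : ideal b -> b `<=` ideal_gen (b `&` degree_le D) ->
  gen_degree_le D b.
Proof.
move=> idb bD; apply/seteqP; split=> //.
by apply: ideal_gen_sub => // x [].
Qed.

Lemma gen_degree_le_ideal D b : gen_degree_le D b -> ideal b.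
Proof. by move=> ->; exact: ideal_gen_ideal. Qed.

Lemma gen_degree_leS D E b : (D <= E)%N -> gen_degree_le D b -> gen_degree_le E b.
Proof.
move=> DE bD; apply: mk_gen_degree_le; first exact: gen_degree_le_ideal bD.
rewrite {1}bD; apply: ideal_gen_mono => x [bx Dx]; split=> //; exact: degree_leS DE _ _.
Qed.

Lemma gen_degree_leT : gen_degree_le 0 (@setT R).
Proof.
apply: mk_gen_degree_le => // x _.
rewrite -[x]mulr1; apply: (idealMl _ (ideal_gen_ideal _)); apply: sub_ideal_gen.
by split=> //; exact: degree_le1.
Qed.

Lemma gen_degree_le_mul D E I J : gen_degree_le D I -> gen_degree_le E J ->
  gen_degree_le (D + E) (ideal_mul I J).
Proof.
move=> ID JE; apply: mk_gen_degree_le; first exact: ideal_mul_ideal.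
set K := ideal_gen _; have idK : ideal K := ideal_gen_ideal _.
apply: ideal_mul_sub => // x z; rewrite {1}ID => + Jz.
have : ideal_gen (I `&` degree_le D) `<=` [set x | K (x * z)].
  apply: ideal_gen_sub; first exact: ideal_colon.
  move=> {}x [Ix Dx] /=; move: Jz; rewrite {1}JE.
  have : ideal_gen (J `&` degree_le E) `<=` [set z | K (x * z)].
    apply: ideal_gen_sub; first exact: ideal_preim.
    move=> {}z [Jz Ez]; apply: sub_ideal_gen.
    by split; [exact: mem_ideal_mul|exact: degree_leM].
  exact.
exact.
Qed.

Lemma gen_degree_le_exp D I m : gen_degree_le D I -> gen_degree_le (D * m) (ideal_exp I m).
Proof.
move=> ID; elim: m => [|m ih]; first by rewrite muln0; exact: gen_degree_leT.
by rewrite mulnS; exact: gen_degree_le_mul.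
Qed.

(** Such an ideal is recovered from its trace on the finite set [degree_le D], and that set has
    finitely many subsets. *)
Lemma finite_gen_degree_le D : finite_set [set b | gen_degree_le D b].
Proof.
have /finite_seqP[s sD] := finite_degree_le D.
pose g (m : {ffun 'I_(size s) -> bool}) := ideal_gen [set x | exists2 i, m i & x = s`_i].
apply: (@sub_finite_set _ _ (g @` [set: _])); last first.
  by apply: finite_image; exact: finite_setT_fin.
move=> b /= bD; exists [ffun i : 'I_(size s) => `[< b s`_i >]] => //.
rewrite /g [RHS]bD; congr ideal_gen; apply/seteqP; split=> x /=.
  move=> [i]; rewrite ffunE => /asboolP bi ->; split=> //.
  by rewrite sD /=; exact: mem_nth.
move=> [bx]; rewrite sD /= => /(nthP 0)[i si e]; exists (Ordinal si); rewrite /= ?e//.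
by rewrite ffunE; apply/asboolP; rewrite /= e.
Qed.

(* R is a ring of fractions of the subalgebra generated by the y_i. *)
Definition fraction_filtered : Prop := forall (T : finType) (F : T -> R),
  exists (u u' : R) (D : nat),
    [/\ u * u' = 1, degree_le D u & forall i, degree_le D (F i * u)].

Lemma finitely_generated_gen_degree_le b : fraction_filtered -> noetherian R -> ideal b ->
  exists D, gen_degree_le D b.
Proof.
move=> frac noethR idb; have [s bs] := noethR b idb.
have [u [u' [D [uu' Du Ds]]]] := frac 'I_(size s) (fun i => s`_i).
have sb i : i \in s -> b i by move=> si; rewrite bs; exact: sub_ideal_gen.
exists D; apply: mk_gen_degree_le => //.
have idg : ideal (ideal_gen (b `&` degree_le D)) := ideal_gen_ideal _.
rewrite [X in X `<=` _]bs; apply: ideal_gen_sub => // x /= xs.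
rewrite -[x]mulr1 -uu' mulrA; apply: (idealMr _ idg); apply: sub_ideal_gen.
split; first by apply: idealMr => //; exact: sb.
by have /(nthP 0)[i si <-] := xs; exact: (Ds (Ordinal si)).
Qed.

Section CartierDegree.
Variable p : nat.
Hypothesis k_char : p \in [pchar k].
Hypothesis frac : fraction_filtered.

Let charp : p \in [pchar R]. Proof. by rewrite pchar_lalg. Qed.
Let p_gt1 : (1 < p)%N. Proof. exact/prime_gt1/(pcharf_prime k_char). Qed.
Let p_gt0 : (0 < p)%N. Proof. exact: ltnW. Qed.

Lemma finField_pth_root (c : k) : exists d, c = d ^+ p.
Proof.
have inj : injective (pFrobenius_aut k_char) by exact: fmorph_inj.
by have [g _ gK] := injF_bij inj; exists (g c); rewrite -[LHS]gK pFrobenius_autE.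
Qed.

(** Scalars can leave [th] because each is a p-th power in the finite field. Hence k-subspaces pull
    back to k-subspaces, and degree bounds can be checked on monomials. *)
Lemma cartier_map_semilinear (th : R -> R) c x : cartier_map p th ->
  exists d, th (c *: x) = d *: th x.
Proof.
move=> [_ thM]; have [d ->] := finField_pth_root c; exists d.
by rewrite -[x in LHS]mul1r scalerAl -(expr1n R p) -exprZn thM -scalerAl mul1r.
Qed.

Lemma submodule_cartier_preim (th : R -> R) (W : set R) v : cartier_map p th ->
  submodule W -> submodule [set x | W (th (x * v))].
Proof.
move=> cth subW; apply: mk_submodule => /= [|x z Wx Wz|c x Wx].
- by rewrite mul0r (cartier_map0 cth); exact: (submodule0 subW).
- by rewrite mulrDl cth.1; exact: (submoduleD subW).
- rewrite -scalerAl; have [d ->] := cartier_map_semilinear c (x * v) cth.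
  exact: (submoduleZ _ subW).
Qed.

Lemma monom_edivn al : monom al =
  monom (fun i => al i %/ p)%N ^+ p * monom (fun i => al i %% p)%N.
Proof.
rewrite -monomX -monomD; apply: eq_bigr => i _.
by rewrite -divn_eq.
Qed.

Lemma mdegree_divn al : (mdegree (fun i => al i %/ p) <= mdegree al %/ p)%N.
Proof.
by rewrite leq_divRL// -mdegreeM; apply: leq_sum => i _; exact: leq_trunc_div.
Qed.

Lemma mdegree_modn al : (mdegree (fun i => al i %% p) <= N * p)%N.
Proof.
rewrite -[N in (N * p)%N]card_ord -sum_nat_const; apply: leq_sum => i _.
by rewrite ltnW// ltn_pmod.
Qed.

(** A monomial is a p-th power, leaving [th] with its degree divided by p, times a monomial with
    exponents below p. Only finitely many of the latter exist, so one unit u and one G serve for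
    all. Scaling L by u'^p compensates for scaling [th] by u. *)
Lemma exists_bounded_dual_basis : frob_dual_basis p (1 : R) ->
  exists (T : finType) (th : T -> R -> R) (L : T -> R) (G : nat),
    [/\ forall i, cartier_map p (th i),
        forall x, x = \sum_i th i x ^+ p * L i
      & forall i D, degree_le D `<=` [set x | degree_le (D %/ p + G) (th i x)]].
Proof.
move=> [T [th [L [cth thL]]]].
have [u [u' [G [uu' Gu Gth]]]] := @frac (T * {ffun 'I_N -> 'I_p})%type
  (fun i => th i.1 (monom (fun j => i.2 j))).
exists T, (fun i x => u * th i x), (fun i => u' ^+ p * L i), G; split.
- by move=> i; exact: cartier_map_scale.
- move=> x; rewrite -[LHS]mul1r -(expr1n R p) thL; apply: eq_bigr => i _.
  by rewrite -[LHS]mul1r -(expr1n R p) -uu' !exprMn mulrACA.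
move=> i D.
have cthu : cartier_map p (fun x => u * th i x) by exact: cartier_map_scale.
have subV := degree_le_submodule (D %/ p + G).
have : degree_le D `<=` [set x | degree_le (D %/ p + G) (u * th i (x * 1))].
  apply: degree_le_sub; first exact: (submodule_cartier_preim 1 cthu subV).
  move=> al alD /=; rewrite mulr1 {1}monom_edivn (cth i).2 mulrCA.
  apply: degree_leM.
    by apply: monom_degree; rewrite (leq_trans (mdegree_divn al))// leq_div2r.
  rewrite mulrC (_ : monom (fun i => al i %% p)%N =
    monom (fun j => [ffun j => Ordinal (ltn_pmod (al j) p_gt0)] j)).
    exact: (Gth (i, [ffun j => Ordinal (ltn_pmod (al j) p_gt0)])).
  by apply: eq_bigr => j _; rewrite ffunE.
by move=> h x /h /=; rewrite mulr1.
Qed.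

Variables (T : finType) (th : T -> R -> R) (G : nat).
Hypothesis cth : forall i, cartier_map p (th i).
Hypothesis thG : forall i D, degree_le D `<=` [set x | degree_le (D %/ p + G) (th i x)].

(** C(b) is generated by the th_i(x v) with v in b of degree at most D and x a monomial with
    exponents below p. Such an x has degree at most N p, which accounts for N; [thG] adds G. *)
Lemma gen_degree_le_cartier_root D b : gen_degree_le D b ->
  gen_degree_le (D %/ p + (N + G)) (cartier_root th b).
Proof.
move=> bD; have idb := gen_degree_le_ideal bD.
apply: mk_gen_degree_le; first exact: cartier_root_ideal.
set I' := ideal_gen _; have idI' : ideal I' := ideal_gen_ideal _.
have subI' : submodule I'.
  apply: mk_submodule => [|u v Iu Iv|c u Iu]; [exact: (ideal0 idI')|exact: (idealD idI')|].
  by rewrite -[u]mul1r scalerAl; exact: (idealMl _ idI').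
have monoI i v be : b v -> degree_le D v -> (mdegree be <= N * p)%N -> I' (th i (monom be * v)).
  move=> bv Dv beN; apply: sub_ideal_gen; split.
    by apply: mem_cartier_root; exact: idealMl.
  rewrite addnA [(D %/ p + N)%N]addnC -divnMDl//; apply: thG; apply: degree_leM => //; exact: monom_degree.
have polyI i v E x : b v -> degree_le D v -> degree_le E x -> I' (th i (x * v)).
  move=> bv Dv; have : degree_le E `<=` [set x | I' (th i (x * v))].
    apply: degree_le_sub; first exact: submodule_cartier_preim.
    move=> al _ /=; rewrite monom_edivn -mulrA (cth i).2; apply: (idealMl _ idI').
    exact: monoI (mdegree_modn al).
  exact.
(* An arbitrary r equals u'^p times r u u^(p-1). The first factor leaves [th i] as u', and the
   second has a degree. *)
have genI i v r : b v -> degree_le D v -> I' (th i (r * v)).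
  move=> bv Dv; have [u [u' [E [uu' Eu /(_ tt) Er]]]] := @frac unit (fun=> r).
  have -> : r * v = u' ^+ p * (r * u * u ^+ p.-1 * v).
    rewrite -[r * u * _]mulrA -exprS prednK// mulrA mulrCA -exprMn [u' * u]mulrC uu'.
    by rewrite expr1n mulr1.
  rewrite (cth i).2; apply: (idealMl _ idI').
  by apply: (polyI i v (E + E * p.-1)%N) => //; apply: degree_leM => //; exact: degree_leX.
apply: ideal_gen_sub => // _ [i [x [bx ->]]].
have : ideal_gen (b `&` degree_le D) `<=` [set x | forall a, I' (th i (a * x))].
  apply: ideal_gen_sub; first exact: (ideal_cartier_preim cth i idI').
  by move=> v [bv Dv] a; exact: genI.
by rewrite -bD => /(_ x bx 1); rewrite mul1r.
Qed.

(** The reserve 2 (N + G) reproduces itself: since p >= 2, division by p leaves at most N + G, and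
    one root adds N + G again. *)
Lemma gen_degree_le_iter_cartier_root e X b :
  gen_degree_le (X * p ^ e + 2 * (N + G)) b ->
  gen_degree_le (X + 2 * (N + G)) (iter e (cartier_root th) b).
Proof.
elim: e b => [|e ih] b; first by rewrite muln1.
move=> /gen_degree_le_cartier_root bD; rewrite iterSr; apply: ih.
apply: gen_degree_leS bD.
rewrite expnSr mulnA divnMDl// -addnA leq_add2l.
have : (2 * (N + G) %/ p <= N + G)%N.
  rewrite -(@leq_pmul2r p)// (leq_trans (leq_trunc_div _ _))// mulnC leq_mul2l.
  by rewrite p_gt1 orbT.
lia.
Qed.

End CartierDegree.
End DegreeFiltration.

Section EssentiallyFiniteType.
Variables (k : finFieldType) (R : comAlgType k).

Lemma eft_fraction_filtered : essentially_finite_type R ->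
  exists (N : nat) (y : 'I_N -> R), fraction_filtered y.
Proof.
move=> [A [S [f [[s sA] multS locf]]]].
pose y (i : 'I_(size s)) := f s`_i.
exists (size s), y.
have fA a : exists D, degree_le y D (f a).
  suff : [set: A] `<=` [set a | exists D, degree_le y D (f a)] by exact.
  rewrite -sA; apply: smallest_sub.
    split.
    - apply: mk_submodule => /= [|u v [D Du] [E Ev]|c u [D Du]].
      + by exists 0%N; rewrite rmorph0; exact: submodule0 (degree_le_submodule y 0).
      + exists (maxn D E); rewrite rmorphD.
        apply: (submoduleD (degree_le_submodule y _)).
          by move: Du; apply: degree_leS; exact: leq_maxl.
        by move: Ev; apply: degree_leS; exact: leq_maxr.
      + by exists D; rewrite linearZ; exact: (submoduleZ _ (degree_le_submodule y _)).
    - by exists 0%N; rewrite rmorph1; exact: degree_le1.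
    - by move=> u v [D Du] [E Ev]; exists (D + E)%N; rewrite rmorphM; exact: degree_leM.
  move=> x /(nthP 0)[i si <-]; exists 1%N.
  rewrite (_ : f _ = monom y (fun j => (j == Ordinal si) : nat)).
    apply: monom_degree; rewrite /mdegree (bigD1 (Ordinal si))//= eqxx big1// => j.
    by move=> /negPf->.
  rewrite /monom (bigD1 (Ordinal si))//= eqxx expr1 big1 ?mulr1// => j /negPf->.
  by rewrite expr0.
move=> T F; have [v [Sv [u uE]]] := common_denominator multS locf F.
have [unit _ _] := locf; have [v' vv'] := unit v Sv.
have [D0 D0v] := fA v.
have /choice[Du DuE] : forall i, exists D, degree_le y D (f (u i)) by move=> i; exact: fA.
exists (f v), v', (maxn D0 (\max_i Du i)); split=> //.
  by move: D0v; apply: degree_leS; exact: leq_maxl.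
move=> i; rewrite uE; move: (DuE i); apply: degree_leS.
by rewrite (leq_trans (leq_bigmax i))// leq_maxr.
Qed.

End EssentiallyFiniteType.

(** * Test ideals *)

Section Ceil.
Variable K : realType.

Lemma absz_ceil_le (x : K) j : 0 <= x -> (`|Num.ceil x| <= j)%N = (x <= j%:R).
Proof.
move=> x0; have c0 : 0 <= Num.ceil x by rewrite ceil_ge0 (lt_le_trans _ x0)// ltrN10.
by rewrite -lez_nat gez0_abs// ceil_le_int pmulrn.
Qed.

Lemma absz_ceil_ge (x : K) : 0 <= x -> x <= `|Num.ceil x|%:R.
Proof. by move=> x0; rewrite -absz_ceil_le. Qed.

Lemma absz_ceilDn (x : K) j : 0 <= x -> `|Num.ceil (x + j%:R)|%N = (`|Num.ceil x| + j)%N.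
Proof.
move=> x0; have c0 : 0 <= Num.ceil x by rewrite ceil_ge0 (lt_le_trans _ x0)// ltrN10.
rewrite ceilDrz ?rpred_nat// (_ : j%:R = (Posz j)%:~R)// intrKceil.
by apply/eqP; rewrite -eqz_nat PoszD !gez0_abs// addr_ge0.
Qed.

End Ceil.

Lemma noetherian_union (R : comNzRingType) (J : nat -> set R) : noetherian R ->
  (forall e, ideal (J e)) -> (forall e, J e `<=` J e.+1) ->
  exists E, forall e, (E <= e)%N -> J e = \bigcup_i J i.
Proof.
move=> noethR idJ JS.
have Jle m n : (m <= n)%N -> J m `<=` J n.
  by move=> /subnKC <-; elim: (n - m)%N => [|d ih] x; rewrite ?addn0// addnS => /ih/JS.
have idU : ideal (\bigcup_i J i).
  apply: mk_ideal => [|x z [i _ Jx] [j _ Jz]|a x [i _ Jx]].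
  - by exists 0%N => //; exact: ideal0.
  - exists (maxn i j) => //; apply: idealD => //.
      by apply: Jle Jx; exact: leq_maxl.
    by apply: Jle Jz; exact: leq_maxr.
  - by exists i => //; exact: idealMl.
have [s Us] := noethR _ idU.
have [E sE] : exists E, forall x, x \in s -> J E x.
  have : forall x, x \in s -> (\bigcup_i J i) x by move=> x xs; rewrite Us; exact: sub_ideal_gen.
  elim: (s) => [|x t ih] tU; first by exists 0%N.
  have [|E tE] := ih; first by move=> z zt; apply: tU; rewrite inE zt orbT.
  have [i _ Jx] := tU x (mem_head _ _).
  exists (maxn i E) => z; rewrite inE => /predU1P[->|/tE].
    by apply: Jle Jx; exact: leq_maxl.
  by apply: Jle; exact: leq_maxr.
exists E => e Ee; apply/seteqP; split=> [x Jx|]; first by exists e.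
rewrite Us; apply: ideal_gen_sub => // x /sE; exact: Jle.
Qed.

Section PowerProducts.
Variables (R : comNzRingType) (n p : nat) (a : 'I_n -> set R).
Hypothesis charp : p \in [pchar R].
Hypothesis a_ideal : forall i, ideal (a i).
Implicit Types (m u : 'I_n -> nat).

Definition power_prod m : set R := \big[@ideal_mul R/setT]_(i < n) ideal_exp (a i) (m i).

Lemma power_prod_ideal m : ideal (power_prod m).
Proof.
rewrite /power_prod; elim/big_rec: _ => [|i I _ _]; first exact: ideal_setT.
exact: ideal_mul_ideal.
Qed.

Lemma power_prodS m u : (forall i, (m i <= u i)%N) -> power_prod u `<=` power_prod m.
Proof.
move=> mu; rewrite /power_prod; elim/big_rec2: _ => [//|i I J _ IJ].
by apply: ideal_mulS => //; exact: ideal_exp_anti.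
Qed.

Lemma power_prod_frob_power m e :
  frob_power (power_prod m) (p ^ e) `<=` power_prod (fun i => m i * p ^ e)%N.
Proof.
rewrite /power_prod; elim/big_rec2: _ => [//|i I J _ IJ].
by rewrite frob_power_mul//; apply: ideal_mulS => //; exact: frob_power_exp.
Qed.

Lemma power_prod_skoda (s : 'I_n -> seq R) e m u :
    (forall i, a i = adjoin [set 0] (s i)) ->
    (forall i, u i = 0%N \/ (size (s i) * p ^ e <= m i)%N) ->
  power_prod (fun i => m i + p ^ e * u i)%N =
  ideal_mul (frob_power (power_prod u) (p ^ e)) (power_prod m).
Proof.
move=> aE mu; rewrite /power_prod.
have pe0 : (0 < p ^ e)%N by rewrite expn_gt0 prime_gt0// (pcharf_prime charp).
elim/big_rec3: _ => [|i I J U _ ->].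
  by rewrite frob_powerT ideal_mulT//; exact: ideal_setT.
by rewrite {1}aE ideal_exp_skoda// -aE frob_power_mul// ideal_mulACA.
Qed.

End PowerProducts.

Section TestIdealTheory.
Variables (K : realType) (n p : nat) (R : comNzRingType) (a : 'I_n -> set R).
Hypotheses (charp : p \in [pchar R]) (noethR : noetherian R).
Hypothesis a_ideal : forall i, ideal (a i).
Variables (T : finType) (th : T -> R -> R) (L : T -> R).
Hypotheses (cth : forall i, cartier_map p (th i))
  (thL : forall x, x = \sum_i th i x ^+ p * L i).
Implicit Types (c t : 'I_n -> {nonneg K}) (b : 'I_n -> nat).

Let p_gt0 : (0 < p)%N. Proof. exact/prime_gt0/(pcharf_prime charp). Qed.

Definition ceil_exponents c e i := `|Num.ceil ((c i)%:num * (p ^ e)%:R)|%N.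

Let scaled_ge0 c e i : 0 <= (c i)%:num * (p ^ e)%:R.
Proof. by rewrite mulr_ge0. Qed.

Lemma ceil_exponentsS c e i : (ceil_exponents c e.+1 i <= ceil_exponents c e i * p ^ 1)%N.
Proof.
rewrite absz_ceil_le// expn1 expnSr !natrM mulrA ler_wpM2r//.
exact: absz_ceil_ge.
Qed.

Lemma ceil_exponents_le c e i (X : nat) : (c i)%:num <= X%:R ->
  (ceil_exponents c e i <= X * p ^ e)%N.
Proof. by move=> cX; rewrite absz_ceil_le// natrM ler_wpM2r. Qed.

Lemma test_ideal_atE c e :
  test_ideal_at p a c e = iter e (cartier_root th) (power_prod a (ceil_exponents c e)).
Proof. by rewrite /test_ideal_at (frob_root_iter charp cth thL)//; exact: power_prod_ideal. Qed.

Lemma test_ideal_at_ideal c e : ideal (test_ideal_at p a c e).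
Proof. by rewrite test_ideal_atE; apply: iter_cartier_root_ideal; exact: power_prod_ideal. Qed.

(** Since ceil(c p^(e+1)) <= p ceil(c p^e), the p-th Frobenius power of the product at stage e lies
    in the product at stage e + 1, and C undoes that Frobenius power. *)
Lemma test_ideal_atS c e : test_ideal_at p a c e `<=` test_ideal_at p a c e.+1.
Proof.
rewrite !test_ideal_atE iterSr; apply: iter_cartier_rootS.
apply: (sub_cartier_root_frob_power charp cth thL); first exact: power_prod_ideal.
rewrite -[X in frob_power _ X]expn1.
move=> x /(power_prod_frob_power charp a_ideal); move: x.
by apply: power_prodS => // i; exact: ceil_exponentsS.
Qed.

Lemma test_ideal_stable c : exists E, forall e, (E <= e)%N ->
  test_ideal_at p a c e = test_ideal p a c.
Proof.
have [E hE] := noetherian_union noethR (test_ideal_at_ideal c) (@test_ideal_atS c).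
exists E => e /hE ->; apply/seteqP; split=> x [i _ ix]; last by exists i.
(* Stage 0 is absent from the union in [test_ideal], so an element of stage i is placed in stage i +
   1. *)
by exists i.+1 => //; exact: test_ideal_atS.
Qed.

(** The exponents of t at stage e + e' are those of c at stage e', so the last e roots are applied
    to the test ideal of c. *)
Lemma test_ideal_div c t e : (forall i, (t i)%:num = (c i)%:num / (p ^ e)%:R) ->
  test_ideal p a t = iter e (cartier_root th) (test_ideal p a c).
Proof.
move=> tc; have [E1 h1] := test_ideal_stable t; have [E2 h2] := test_ideal_stable c.
have pe0 : (p ^ e)%:R != 0 :> K by rewrite pnatr_eq0 -lt0n expn_gt0 p_gt0.
rewrite -(h1 (e + maxn E1 E2)%N); last by rewrite (leq_trans (leq_maxl E1 E2))// leq_addl.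
rewrite -(h2 (maxn E1 E2)) ?leq_maxr// !test_ideal_atE iterD.
congr (iter _ _ (iter _ _ (power_prod _ _))); apply/funext => i.
by rewrite /ceil_exponents tc expnD natrM mulrA divfK.
Qed.

Variables (s : 'I_n -> seq R) (r : nat).
Hypotheses (aE : forall i, a i = adjoin [set 0] (s i)) (sr : forall i, (size (s i) <= r)%N).

(** At stage e the shift b adds b p^e to the exponents. Where b exceeds r, keeping r p^e of this
    leaves the reserve that [power_prod_skoda] needs; the rest splits off as a Frobenius power,
    which the e-fold root turns into an ordinary factor. *)
Lemma test_ideal_skoda c t t' b : (forall i, (t i)%:num = (c i)%:num + (b i)%:R) ->
    (forall i, (t' i)%:num = (c i)%:num + (minn (b i) r)%:R) ->
  test_ideal p a t = ideal_mul (power_prod a (fun i => b i - r)%N) (test_ideal p a t').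
Proof.
move=> tc t'c; have [E1 h1] := test_ideal_stable t; have [E2 h2] := test_ideal_stable t'.
rewrite -(h1 (maxn E1 E2)) ?leq_maxl// -(h2 (maxn E1 E2)) ?leq_maxr// !test_ideal_atE.
set e := maxn _ _.
rewrite -(iter_cartier_root_mul charp cth)//; last exact: power_prod_ideal.
rewrite -(power_prod_skoda charp aE); last first.
  move=> i; have [br|rb] := leqP (b i) r; first by left; apply/eqP; rewrite subn_eq0.
  right; rewrite /ceil_exponents t'c (minn_idPr (ltnW rb)) mulrDl -natrM absz_ceilDn//.
  by rewrite (leq_trans _ (leq_addl _ _))// leq_mul2r sr orbT.
congr (iter _ _ (power_prod _ _)); apply/funext => i.
rewrite /ceil_exponents tc t'c !mulrDl -!natrM !absz_ceilDn//.
rewrite -addnA [(p ^ e * _)%N]mulnC -mulnDl; congr (_ + _ * _)%N.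
by rewrite /minn; case: ltnP; lia.
Qed.

End TestIdealTheory.

Lemma finite_nat_bound (A : set nat) : finite_set A -> exists M, forall x, A x -> (x < M)%N.
Proof.
move=> /finite_seqP[s ->]; exists (\max_(x <- s) x).+1 => x xs.
by rewrite ltnS; exact: (@bigmaxn_sup_seq _ s x).
Qed.

(** * A criterion for p-fractals from local finiteness and shifts *)

Section ConstancyFractal.
Variables (K : realType) (n p : nat).

Definition translate (b : 'I_n -> nat) (c : 'I_n -> {nonneg K}) : 'I_n -> {nonneg K} :=
  fun i => ((c i)%:num + (b i)%:R)%:nng.

Definition T_arg (q : nat) (b : 'I_n -> nat) (c : 'I_n -> {nonneg K}) : 'I_n -> {nonneg K} :=
  fun i => (((c i)%:num + (b i)%:R) / q%:R)%:nng.

Hypothesis p_gt0 : (0 < p)%N.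
Variable (V : Type) (tau : ('I_n -> {nonneg K}) -> V) (g : V -> nat) (r : nat).
Implicit Types (c t : 'I_n -> {nonneg K}) (b : 'I_n -> nat).

Hypothesis g_inj : forall c d, g (tau c) = g (tau d) -> tau c = tau d.
Hypothesis tau_finite : forall X : nat,
  finite_set [set tau c | c in [set c | forall i, (c i)%:num <= X%:R]].
Hypothesis tau_shift : forall e b, exists f : V -> V, forall c t t',
  (forall i, (t i)%:num = ((c i)%:num + (b i)%:R) / (p ^ e)%:R) ->
  (forall i, (t' i)%:num = (c i)%:num + (minn (b i) r)%:R) ->
  tau t = f (tau t').

Lemma code_bound (X : nat) : exists M, forall c, (forall i, (c i)%:num <= X%:R) ->
  (g (tau c) < M)%N.
Proof.
have [M hM] := finite_nat_bound (finite_image g (tau_finite X)).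
by exists M => c cX; apply: hM; exists (tau c) => //; exists c.
Qed.

Lemma constancy_fractal : p_fractal p (fun c => (g (tau c))%:R).
Proof.
move=> l; rewrite /p_fractal_on /finitely_generated.
set Psi := [set psi | _]; suff /finite_seqP[s ->] : finite_set Psi by exists s.
(* The successor makes X positive, so b < q = p^e gives X + b <= X q, and the arguments (t + b) / q
   stay below X. *)
pose X := (\max_i `|Num.ceil (l i)%:num|).+1.
have lX i : (l i)%:num <= X%:R.
  rewrite (le_trans (absz_ceil_ge (ltW _)))// ler_nat ltnW// ltnS.
  exact: (leq_bigmax i).
have [M1 hM1] := code_bound (X + r)%N; have [M2 hM2] := code_bound X.
pose shift t (be : {ffun 'I_n -> 'I_r.+1}) := translate (fun i => be i : nat) t.
pose D := {ffun {ffun 'I_n -> 'I_r.+1} -> 'I_M1.+1}.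
(* The class of t lists the labels of its translates by all of {0, ..., r}^n. By [tau_shift] it
   determines the label at (t + b) / p^e for all e and b at once, and [build] makes functions from
   tables on the classes. *)
pose kap t : D := [ffun be => inord (g (tau (shift t be)))].
pose build (h : {ffun D -> 'I_M2.+1}) : ('I_n -> {nonneg K}) -> rat^o :=
  cutoff l (fun t => (h (kap t) : nat)%:R).
apply: (@sub_finite_set _ _ (build @` [set: _])); last first.
  by apply: finite_image; exact: finite_setT_fin.
move=> _ [e [b [bq ->]]].
have q0 : (0 < p ^ e)%N by rewrite expn_gt0 p_gt0.
pose arg := T_arg (p ^ e) b.
have argX t : box l t -> forall i, (arg t i)%:num <= X%:R.
  move=> tl i /=; rewrite ler_pdivrMr ?ltr0n// -natrM.
  apply: (@le_trans _ _ (X + b i)%:R).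
    by rewrite natrD lerD2r; exact: le_trans (tl i) (lX i).
  by rewrite ler_nat; have := bq i; rewrite /X; nia.
have shiftX t be : box l t -> forall i, (shift t be i)%:num <= (X + r)%:R.
  move=> tl i /=; rewrite natrD lerD//; first exact: le_trans (tl i) (lX i).
  by rewrite ler_nat -ltnS.
have [f fE] := tau_shift e b.
have kap_arg t t' : box l t -> box l t' -> kap t = kap t' -> g (tau (arg t)) = g (tau (arg t')).
  move=> tl t'l tt'; pose be : {ffun 'I_n -> 'I_r.+1} := [ffun i => inord (minn (b i) r)].
  have beE i : (be i : nat) = minn (b i) r by rewrite ffunE inordK// ltnS geq_minr.
  rewrite (fE t (arg t) (shift t be))//=; last by move=> i; rewrite beE.
  rewrite (fE t' (arg t') (shift t' be))//=; last by move=> i; rewrite beE.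
  suff -> : tau (shift t be) = tau (shift t' be) by [].
  apply: g_inj; have /ffunP/(_ be)/(congr1 val) := tt'.
  by rewrite !ffunE /= !inordK// ltnS ltnW// hM1//; exact: shiftX.
have /choice[v vE] : forall k : D, exists v : nat, forall t, box l t -> kap t = k ->
    g (tau (arg t)) = v.
  move=> k; have [[t0 [t0l t0k]]|nex] := pselect (exists t, box l t /\ kap t = k).
    by exists (g (tau (arg t0))) => t tl tk; apply: kap_arg; rewrite // t0k.
  (* A class that misses the box may be given any value. *)
  by exists 0%N => t tl tk; case: nex; exists t.
exists [ffun k => inord (v k)] => //.
apply/funext => t; rewrite /build /cutoff /patch; case: ifPn => // /set_mem tl.
rewrite /T_op ffunE -(vE _ t tl erefl) inordK// ltnS ltnW// hM2//; exact: argX.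
Qed.

End ConstancyFractal.

Section FiniteTestIdeals.
Variables (K : realType) (k : finFieldType) (R : comAlgType k) (n p : nat).
Variable a : 'I_n -> set R.
Hypotheses (k_char : p \in [pchar k]) (noethR : noetherian R).
Hypothesis a_ideal : forall i, ideal (a i).
Variables (N : nat) (y : 'I_N -> R).
Hypothesis frac : fraction_filtered y.
Variables (T : finType) (th : T -> R -> R) (L : T -> R) (G : nat).
Hypotheses (cth : forall i, cartier_map p (th i))
  (thL : forall x, x = \sum_i th i x ^+ p * L i)
  (thG : forall i D, degree_le y D `<=` [set x | degree_le y (D %/ p + G) (th i x)]).

Lemma gen_degree_le_power_prod D (m : 'I_n -> nat) : (forall i, gen_degree_le y D (a i)) ->
  gen_degree_le y (\sum_i D * m i) (power_prod a m).
Proof.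
move=> aD; rewrite /power_prod; elim/big_rec2: _ => [|i I E _ IE].
  exact: gen_degree_leT.
by apply: gen_degree_le_mul => //; exact: gen_degree_le_exp.
Qed.

(** At a stage e where the test ideal is attained, the product of powers is generated in degree n D
    X p^e, and the e-fold root brings this down to n D X + 2 (N + G), whatever e is. *)
Lemma finite_test_ideals (X : nat) :
  finite_set [set test_ideal p a c | c in [set c : 'I_n -> {nonneg K} |
    forall i, (c i)%:num <= X%:R]].
Proof.
have charp : p \in [pchar R] by rewrite pchar_lalg.
have /choice[Da aD] : forall i, exists D, gen_degree_le y D (a i).
  by move=> i; exact: finitely_generated_gen_degree_le.
pose D := (\max_i Da i)%N.
have {}aD i : gen_degree_le y D (a i) by exact: gen_degree_leS (leq_bigmax i) (aD i).
apply: sub_finite_set (finite_gen_degree_le y (n * (D * X) + 2 * (N + G))).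
move=> _ [c cX <-] /=.
have [E hE] := test_ideal_stable charp noethR a_ideal cth thL c.
rewrite -(hE E)// (test_ideal_atE _ charp cth thL).
apply: (gen_degree_le_iter_cartier_root k_char frac cth thG).
apply: gen_degree_leS (gen_degree_le_power_prod _ aD).
rewrite (leq_trans _ (leq_addr _ _))// -mulnA -[n in (n * _)%N]card_ord -sum_nat_const.
by apply: leq_sum => i _; rewrite -mulnA leq_mul2l ceil_exponents_le ?orbT.
Qed.

End FiniteTestIdeals.

Theorem theorem4p6 (K : realType) (p : nat) (k : finFieldType)
    (R : comAlgType k) (n : nat) (a : 'I_n -> set R)
    (k_char : p \in [pchar k])
    (R_regular : regular R)
    (R_F_finite : F_finite R p)
    (R_eft : essentially_finite_type R)
    (a_ideal : forall i, ideal (a i))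
    (a_neq0 : forall i, a i <> [set 0]) :
  exists phi : ('I_n -> {nonneg K}) -> nat,
    [/\ p_fractal p (fun c => (phi c)%:R),
        forall c d : 'I_n -> {nonneg K},
          test_ideal p a c = test_ideal p a d <-> phi c = phi d
      & forall c : 'I_n -> {nonneg K},
          exists i : nat, constancy_region p a c = phi @^-1` [set i]].
Proof.
have charp : p \in [pchar R] by rewrite pchar_lalg.
have p_gt0 : (0 < p)%N := prime_gt0 (pcharf_prime k_char).
have noethR : noetherian R by case: R_regular.
have [N [y frac]] := eft_fraction_filtered R_eft.
have [T [th [L [G [cth thL thG]]]]] := exists_bounded_dual_basis k_char frac
  (regular_frob_dual_basis charp R_regular R_F_finite).
have tau_finite := finite_test_ideals K k_char noethR a_ideal frac cth thL thG.
pose tau c := test_ideal (K := K) p a c.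
(* Labels in [nat] exist because the integral boxes exhaust the orthant and each contributes
   finitely many test ideals. *)
have /countable_injP[g g_inj] : countable (range tau).
  rewrite (_ : range tau = \bigcup_(X in [set: nat])
    [set tau c | c in [set c | forall i, (c i)%:num <= X%:R]]).
    by apply: bigcup_countable => // X _; apply: finite_set_countable; exact: tau_finite.
  apply/seteqP; split=> [_ [c _ <-]|_ [X _ [c _ <-]]]; last by exists c.
  exists (\max_i `|Num.ceil (c i)%:num|)%N => //; exists c => // i.
  by rewrite (le_trans (absz_ceil_ge _))// ler_nat; exact: (leq_bigmax i).
have {}g_inj c d : g (tau c) = g (tau d) -> tau c = tau d.
  by apply: g_inj; rewrite inE; [exists c|exists d].
have phiE c d : test_ideal p a c = test_ideal p a d <-> g (tau c) = g (tau d).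
  by split=> [|/g_inj//]; rewrite /tau => ->.
have /choice[s aE] : forall i, exists s, a i = adjoin [set 0] s.
  by move=> i; exact: noetherian_adjoin.
exists (fun c => g (tau c)); split=> [|//|c].
  (* The threshold r is the largest number of generators among the [a i], so that one r serves all
     coordinates. *)
  apply: (constancy_fractal (r := \max_i size (s i)) p_gt0 g_inj tau_finite) => e b.
  exists (fun J => iter e (cartier_root th)
    (ideal_mul (power_prod a (fun i => b i - \max_i size (s i))%N) J)).
  move=> c t t' tE t'E.
  rewrite /tau (test_ideal_div charp noethR a_ideal cth thL (c := translate b c) (t := t) (e := e))//.
  congr iter.
  apply: (test_ideal_skoda charp noethR a_ideal cth thL aE _ (c := c)) => // i.
  exact: (leq_bigmax i).
exists (g (tau c)); apply/seteqP.
by split=> d /= /phiE.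
Qed.
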